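(* In Game I (the sequential Showcase Showdown game with unlimited spins and $n$ players), suppose that $r$ players ($1\le r\le n$) are still to play, and let $M_r$ be the maximum score of the players who have already played (with $M_r=0$ if nobody has played yet). Then the optimum threshold for the next player is $\max\{\theta_r,M_r\}$.
   Context: Game I: there are players $A_1,\dots,A_n$, who take their turns in this order, each having one turn. In his turn, player $A_i$ starts with $S(A_i)=0$ and successively draws independent values from the uniform distribution on $[0,1]$ (each draw is a ''play'' or ''spin''), adding each value to $S(A_i)$. He repeats this until either he decides to stop or $S(A_i)>1$. If he stops with $S(A_i)\le 1$, his score is $S(A_i)$; otherwise his score is irrevocably set to $0$. Then the next player starts his turn. All draws of all players are independent. Each player knows the scores of all previous players before and during his turn. The winner is the player with the greatest score, and there is a draw (no winner) if all scores are $0$; a player stopping with a score not exceeding the maximum of the previous scores has winning probability $0$. The winner's payoff is $1$, so each player's aim is to maximize his own probability of winning, and all later players are assumed to do likewise. Optimum threshold: a value $\kappa\in[0,1]$ such that the player's winning probability is maximized by the policy: while his current accumulated total $S$ satisfies $S<\kappa$, continue playing; when $S>\kappa$, stop. (At least one spin is made.) For each integer $r\ge 1$, $\theta_r$ denotes the unique solution $x\in[0,1]$ of $$\left(1-e^{x}+xe^{x}\right)^{r-1}=\int_x^1\left(1-e^{t}+te^{t}\right)^{r-1}dt$$ (with the convention $0^0=1$, so $\theta_1=0$). *)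

(* Defs.v *)
From HB Require Import structures.
From mathcomp Require Export all_boot all_order all_algebra.
From mathcomp Require Export all_classical all_reals all_analysis.

Set Implicit Arguments.
Unset Strict Implicit.
Unset Printing Implicit Defensive.

Import Order.TTheory GRing.Theory Num.Theory.
Import numFieldNormedType.Exports.

Local Open Scope classical_set_scope.
Local Open Scope ring_scope.

(** Players are numbered 0, ..., n-1 in playing order, and a history is the
    list of the scores of the players who have already played: the player to
    move after the history [h] is player number [size h]. *)

Section Turn.
Context {R : realType}.

(** The argument is the list of values drawn so far in the current turn, in
    order, and [true] means stop.  The value at [[::]] is never consulted, since
    at least one spin is made. *)
Definition policy := seq R -> bool.

(** One policy for every history; the number of the player is the length of
    the history. *)
Definition profile := seq R -> policy.

Definition measurable_policy (pi : policy) : Prop :=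
  forall k, measurable_fun [set: k.-tuple R] (fun t : k.-tuple R => pi t).

Definition measurable_profile (sigma : profile) : Prop :=
  forall m k, measurable_fun [set: m.-tuple R * k.-tuple R]
    (fun z : m.-tuple R * k.-tuple R => sigma z.1 z.2).

Definition total (u : nat -> R) (k : nat) : R := \sum_(j < k) u j.

(** The player stops, or is bust, after having drawn [u 0, ..., u k.-1]. *)
Definition turn_over (pi : policy) (u : nat -> R) (k : nat) : bool :=
  (0 < k)%N && ((1 < total u k) || pi (mkseq u k)).

(** A turn that never ends (which has probability 0 when the draws are
    independent and uniform) scores 0. *)
Definition turn_score (pi : policy) (u : nat -> R) : R :=
  if pselect (exists k, turn_over pi u k) is left ended then
    let s := total u (ex_minn ended) in if s <= 1 then s else 0
  else 0.

(** The scores at the end of the game if [m] more players play after [h]; the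
    [k]-th draw of player [i] is [u i k]. *)
Fixpoint play (sigma : profile) (u : nat -> nat -> R) (m : nat) (h : seq R)
    : seq R :=
  if m is m'.+1 then
    play sigma u m' (rcons h (turn_score (sigma h) (u (size h))))
  else h.

(** The condition [0 < s`_p] makes the game a draw when all scores are 0. *)
Definition wins (p : nat) (s : seq R) : Prop :=
  0 < s`_p /\ forall j, (j < size s)%N -> j <> p -> s`_j < s`_p.

Definition valid_history (h : seq R) : Prop :=
  forall x, x \in h -> 0 <= x <= 1.

Definition max_score (h : seq R) : R := \big[Num.max/0]_(x <- h) x.

(** What [pi] decides at a total equal to [kappa] is left unspecified. *)
Definition follows_threshold (kappa : R) (pi : policy) : Prop :=
  forall s : seq R,
    (\sum_(x <- s) x < kappa -> pi s = false) /\
    (kappa < \sum_(x <- s) x -> pi s = true).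

(** Note that [0 ^+ 0 = 1]. *)
Definition theta_equation (r : nat) (x : R) : Prop :=
  (1 - expR x + x * expR x) ^+ r.-1 =
  \int[lebesgue_measure]_(t in `[x, 1]) ((1 - expR t + t * expR t) ^+ r.-1).

Definition theta (r : nat) : R :=
  xget 0 [set x | 0 <= x <= 1 /\ theta_equation r x].

End Turn.
Arguments policy : clear implicits.
Arguments profile : clear implicits.

Section Game.
Context {R : realType} {d : measure_display} {Omega : measurableType d}.
Variable P : probability Omega R.

Definition mutually_independent (I : eqType) (X : I -> {RV P >-> R}) : Prop :=
  forall (s : seq I) (B : I -> set R), uniq s -> (forall i, measurable (B i)) ->
    (P (\bigcap_(i in [set` s]) X i @^-1` B i) =
     \prod_(i <- s) P (X i @^-1` B i))%E.

(** Only the draws [U i k] with [i < n] are used in the game. *)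
Definition iid_uniform (n : nat) (U : nat -> nat -> {RV P >-> R}) : Prop :=
  (forall i k, (i < n)%N -> forall B, measurable B ->
     distribution P (U i k) B = uniform_prob (@ltr01 R) B) /\
  mutually_independent (fun ik : 'I_n * nat => U ik.1 ik.2).

(** The probability, at the history [h], that the player to move wins the
    [n]-player game by using [pi], when all later players use [sigma].  As the
    remaining draws are independent of those that led to [h], conditioning on
    [h] amounts to fixing it. *)
Definition win_prob (n : nat) (U : nat -> nat -> {RV P >-> R})
    (sigma : profile R) (h : seq R) (pi : policy R) : \bar R :=
  P [set w | wins (size h)
      (play sigma (fun i k => U i k w) (n - (size h).+1)
         (rcons h (turn_score pi (fun k => U (size h) k w))))].

Definition optimal_policy (n : nat) (U : nat -> nat -> {RV P >-> R})
    (sigma : profile R) (h : seq R) (pi : policy R) : Prop :=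
  forall pi' : policy R, measurable_policy pi' ->
    (win_prob n U sigma h pi' <= win_prob n U sigma h pi)%E.

(** Every player numbered more than [p] plays optimally in every situation,
    given that those after him play [sigma]. *)
Definition optimal_after (n : nat) (U : nat -> nat -> {RV P >-> R})
    (sigma : profile R) (p : nat) : Prop :=
  forall h : seq R, (p < size h < n)%N -> valid_history h ->
    optimal_policy n U sigma h (sigma h).

Definition optimum_threshold (n : nat) (U : nat -> nat -> {RV P >-> R})
    (sigma : profile R) (h : seq R) (kappa : R) : Prop :=
  0 <= kappa <= 1 /\
  forall pi : policy R, measurable_policy pi -> follows_threshold kappa pi ->
    optimal_policy n U sigma h pi.

End Game.

(* Main.v *)
Require Import Defs.
From HB Require Import structures.
From mathcomp Require Import measurable_realfun ring lra zify.

(** Write Q(x) = 1 - e^x + x e^x for the probability that a player who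
    continues until his total exceeds x goes bust.  Suppose that the later
    players play optimally and that the player to move, with r + 1 players still
    to play and score to beat M, stops at x > M.  Each later player must then
    exceed x and fails to do so with probability Q(max(theta_j, x)), where j
    counts the players still to play at his turn.  Hence stopping pays
    prod_(j <= r) Q(max(theta_j, x)), which is Q(x)^r for x >= theta_(r+1),
    because theta is nondecreasing, and at most Q(theta_(r+1))^r below.

    Let kappa = max(theta_(r+1), M), and let F be e^(kappa - x) int_kappa^1 Q^r
    on [0, kappa] and Q(x)^r on (kappa, 1].  F dominates the stopping payoff and
    its own average after one more spin, so no policy wins with probability more
    than F(0), and the threshold policy attains F(0).  If kappa < 1, both
    inequalities are strict on the wrong side of kappa, so every optimal policy
    agrees almost surely with the threshold policy.  This is what makes the
    failure probabilities of the later players computable by backward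
    induction. *)

Set Implicit Arguments.
Unset Strict Implicit.
Unset Printing Implicit Defensive.
Import Order.TTheory GRing.Theory Num.Theory.
Import numFieldNormedType.Exports.
Local Open Scope classical_set_scope.
Local Open Scope ring_scope.

(** * Independence of families of random variables *)

Section Independence.
Context {R : realType} {d : measure_display} {Omega : measurableType d}.
Variable P : probability Omega R.

(** The events independent of a fixed [B] form a Dynkin system; by the pi-lambda theorem it contains
    the sigma-algebra generated by any intersection-stable family inside it. *)
Lemma dynkin_indep (G : set (set Omega)) (B : set Omega) :
    setI_closed G -> G `<=` measurable -> measurable B ->
    (forall A, G A -> P (A `&` B) = (P A * P B)%E) ->
  forall A, <<s G >> A -> P (A `&` B) = (P A * P B)%E.
Proof.
move=> GI Gm mB GB A; rewrite -(setI_closed_g_dynkin_g_sigma_algebra GI) => GA.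
suff: [set A | measurable A /\ P (A `&` B) = (P A * P B)%E] A by case.
apply: (GA [set A | measurable A /\ P (A `&` B) = (P A * P B)%E]); split; last first.
  by move=> C GC; split; [exact: Gm|exact: GB].
split => /=.
- by rewrite setTI probability_setT mul1e.
- move=> C [mC eC]; split; first exact: measurableC.
  have : P (C `&` B) + P (~` C `&` B) = P B.
    rewrite -measureU; [by rewrite -setIUl setUCr setTI|..].
    + exact: measurableI.
    + by apply: measurableI => //; exact: measurableC.
    + by rewrite setIACA setICr set0I.
  rewrite eC probability_setC//.
  have /fineK <- : P C \is a fin_num by exact: fin_num_measure.
  have /fineK <- : P B \is a fin_num by exact: fin_num_measure.
  have /fineK <- : P (~` C `&` B) \is a fin_num.
    by apply: fin_num_measure; apply: measurableI => //; exact: measurableC.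
  by rewrite -!EFinB -!EFinM -!EFinD => -[e]; congr EFin; lra.
- move=> F tF HF; split; first by apply: bigcupT_measurable => k; case: (HF k).
  rewrite setI_bigcupl measure_bigcup//; last 2 first.
  + by move=> k _; apply: measurableI => //; case: (HF k).
  + by under eq_fun do rewrite setIC; exact: trivIset_setIl.
  rewrite measure_bigcup//; last by move=> k _; case: (HF k).
  have /fineK fB : P B \is a fin_num by exact: fin_num_measure.
  rewrite muleC -fB -nneseriesZl; [|by move=> k _; exact: measure_ge0].
  by apply: eq_eseriesr => k _ /=; case: (HF k) => _ ->; rewrite fB muleC.
Qed.

(** By uniqueness of the product measure, the joint law of [X] and [Y] is the product of their laws,
    and Tonelli integrates [Y] out with the value of [X] frozen. *)
Lemma indep_pair_integral d1 d2 (T1 : measurableType d1) (T2 : measurableType d2)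
    (X : Omega -> T1) (Y : Omega -> T2) (f : T1 * T2 -> \bar R) :
    measurable_fun setT X -> measurable_fun setT Y ->
    (forall A B, measurable A -> measurable B ->
      P (X @^-1` A `&` Y @^-1` B) = (P (X @^-1` A) * P (Y @^-1` B))%E) ->
    measurable_fun setT f -> (forall z, 0 <= f z)%E ->
  (\int[P]_w f (X w, Y w) = \int[P]_w \int[P]_w' f (X w, Y w'))%E.
Proof.
move=> mX mY XY mf f0.
pose XX : {mfun Omega >-> T1} := HB.pack X (isMeasurableFun.Build _ _ _ _ _ mX).
pose YY : {mfun Omega >-> T2} := HB.pack Y (isMeasurableFun.Build _ _ _ _ _ mY).
have mXY : measurable_fun setT (fun w => (X w, Y w)) by exact: measurable_fun_pair.
pose XY' : {mfun Omega >-> (T1 * T2)%type} :=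
  HB.pack (fun w => (X w, Y w)) (isMeasurableFun.Build _ _ _ _ _ mXY).
pose PX := distribution P XX.
pose PY := distribution P YY.
pose PXY := distribution P XY'.
have E : forall Z, measurable Z -> (PX \x PY)%E Z = PXY Z.
  apply: product_measure_unique => A B mA mB.
  by rewrite /PX /PY /PXY /distribution /pushforward/= -XY//.
transitivity (\int[PXY]_z f z)%E.
  by rewrite ge0_integral_pushforward//= preimage_setT.
rewrite (eq_measure_integral (PX \x PY)%E); last first.
  by move=> A mA _; first [exact: (E A mA)|exact: (esym (E A mA))].
rewrite fubini_tonelli1// ge0_integral_pushforward//=; last 2 first.
- exact: measurable_fun_fubini_tonelli_F.
- by move=> x _; apply: integral_ge0.
rewrite preimage_setT; apply: eq_integral => w _ /=.
rewrite /fubini_F ge0_integral_pushforward//= ?preimage_setT//.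
by apply: measurableT_comp => //.
Qed.


Variables (I : eqType) (X : I -> {RV P >-> R}).

(** The pi-system that generates the sigma-algebra of the [X i] with [i] in [J]; finite lists are
    used because mutual independence is stated for them. *)
Definition cylinders (J : set I) : set (set Omega) :=
  [set A | exists (s : seq I) (B : I -> set R), [/\ uniq s, [set` s] `<=` J,
     forall i, measurable (B i) & A = \bigcap_(i in [set` s]) X i @^-1` B i]].

Lemma cylinders_measurable J : cylinders J `<=` measurable.
Proof.
move=> _ [s [B [_ _ mB ->]]]; elim: s => [|i s IH].
  by rewrite (_ : \bigcap_(_ in _) _ = setT)//; apply/seteqP; split.
rewrite (_ : \bigcap_(_ in _) _ =
    X i @^-1` B i `&` \bigcap_(j in [set` s]) X j @^-1` B j).
  by apply: measurableI => //; exact: measurable_funPTI.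
apply/seteqP; split => w.
  move=> H; split; first by apply: H; rewrite /= mem_head.
  by move=> j js; apply: H; rewrite /= inE js orbT.
by move=> [Hi Hs] j /=; rewrite inE => /orP[/eqP ->//|]; exact: Hs.
Qed.

Lemma cylinders_setI_closed J : setI_closed (cylinders J).
Proof.
move=> _ _ [s [B [us sJ mB ->]]] [s' [B' [us' sJ' mB' ->]]].
exists (undup (s ++ s')).
exists (fun i => (if i \in s then B i else setT) `&` (if i \in s' then B' i else setT)).
split; first exact: undup_uniq.
- by move=> i /=; rewrite mem_undup mem_cat => /orP[/sJ|/sJ'].
- by move=> i; apply: measurableI; case: ifP.
- apply/seteqP; split => w.
  + move=> [Hs Hs'] i /= _; split; case: ifP => // ii; [exact: Hs|exact: Hs'].
  + move=> H; split => i /= ii.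
    * have /= := H i; rewrite mem_undup mem_cat ii => /(_ isT)[//].
    * have /= := H i; rewrite mem_undup mem_cat ii orbT => /(_ isT)[//].
Qed.

Hypothesis indepX : mutually_independent X.

(** Disjointness of the index sets keeps the concatenation of the two lists duplicate-free, so
    mutual independence applies to it and the product splits. *)
Lemma indep_cylinders J1 J2 A B : J1 `&` J2 = set0 ->
  cylinders J1 A -> cylinders J2 B -> P (A `&` B) = (P A * P B)%E.
Proof.
move=> J12 [s [C [us sJ mC ->]]] [s' [C' [us' sJ' mC' ->]]].
have ss' i : i \in s -> i \notin s'.
  move=> ii; apply/negP => ii'; have : (J1 `&` J2) i by split; [exact: sJ|exact: sJ'].
  by rewrite J12.
have ss2 i : i \in s' -> i \notin s by move=> ii; apply/negP => /ss'; rewrite ii.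
pose D i := if i \in s then C i else C' i.
have -> : \bigcap_(i in [set` s]) X i @^-1` C i `&` \bigcap_(i in [set` s']) X i @^-1` C' i
   = \bigcap_(i in [set` s ++ s']) X i @^-1` D i.
  apply/seteqP; split => w.
  + move=> [Hs Hs'] i /=; rewrite mem_cat /D; case: ifPn => [ii _|_ /= ii]; [exact: Hs|exact: Hs'].
  + move=> H; split => i /= ii.
    * by have /= := H i; rewrite mem_cat /D ii; apply.
    * by have /= := H i; rewrite mem_cat /D ii orbT (negbTE (ss2 _ ii)); apply.
rewrite !indepX//.
- rewrite big_cat/=; congr (_ * _)%E; rewrite !big_seq; apply: eq_bigr => i ii; rewrite /D.
  + by rewrite ii.
  + by rewrite (negbTE (ss2 _ ii)).
- rewrite cat_uniq us us' andbT /=; apply/hasPn => i; exact: ss2.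
- by move=> i; rewrite /D; case: ifP.
Qed.

(** [dynkin_indep] is applied twice, enlarging one cylinder family at a time. *)
Lemma indep_sigma J1 J2 A B : J1 `&` J2 = set0 ->
  <<s cylinders J1 >> A -> <<s cylinders J2 >> B -> P (A `&` B) = (P A * P B)%E.
Proof.
move=> J12 sA sB.
have cm J C : <<s cylinders J >> C -> measurable C.
  by apply: smallest_sub; [exact: sigma_algebra_measurable|exact: cylinders_measurable].
apply: (dynkin_indep (@cylinders_setI_closed J1) (@cylinders_measurable J1)) => //.
  exact: cm sB.
move=> {sA}A cA; rewrite setIC muleC.
apply: (dynkin_indep (@cylinders_setI_closed J2) (@cylinders_measurable J2)) => //.
  exact: cylinders_measurable cA.
move=> {sB}B cB; rewrite setIC muleC; exact: indep_cylinders cA cB.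
Qed.

(** The sample space with the coarser sigma-algebra of the variables indexed by [J]: depending only
    on these variables becomes ordinary measurability on this type. *)
Definition sigma_of (J : set I) := g_sigma_algebraType (cylinders J).

HB.instance Definition _ J := Measurable.on (sigma_of J).

Lemma measurable_id_sigma_of J :
  @measurable_fun _ _ Omega (sigma_of J) setT id.
Proof.
move=> _ A; rewrite setTI preimage_id; move: A.
by apply: smallest_sub; [exact: sigma_algebra_measurable|exact: cylinders_measurable].
Qed.

Lemma measurable_sigma_of (J : set I) (i : I) : J i ->
  @measurable_fun _ _ (sigma_of J) R setT (X i).
Proof.
move=> Ji _ B mB; rewrite setTI; apply: sub_sigma_algebra.
exists [:: i], (fun=> B); split => // [j /=|].
  by rewrite inE => /eqP ->.
apply/seteqP; split => w /=.
  by move=> Xw j /=; rewrite inE => /eqP ->.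
by apply; rewrite /= inE.
Qed.

(** [Y] depends on the variables in [J1] and the second argument of [f] on those in [J2], so the
    second sample point may be replaced by an independent copy. *)
Lemma indep_integral J1 J2 d1 (T1 : measurableType d1) (Y : Omega -> T1)
    (f : T1 * sigma_of J2 -> \bar R) : J1 `&` J2 = set0 ->
    @measurable_fun _ _ (sigma_of J1) T1 setT Y ->
    measurable_fun setT f -> (forall z, 0 <= f z)%E ->
  (\int[P]_w f (Y w, w) = \int[P]_w \int[P]_w' f (Y w, w'))%E.
Proof.
move=> J12 mY mf f0.
apply: (@indep_pair_integral _ _ T1 (sigma_of J2) Y (fun w => w)) => //.
- by apply: (measurableT_comp mY); exact: measurable_id_sigma_of.
- exact: measurable_id_sigma_of.
- move=> A B mA mB; apply: (indep_sigma J12) => //.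
  by have := mY measurableT A mA; rewrite setTI.
Qed.

End Independence.

(** * One turn *)

Section TurnScore.
Context {R : realType}.
Implicit Types (pi : policy R) (u : nat -> R) (g : R -> R).

(** The decision at stage k itself is left out, so that [alive] and [turn_over] at the same k single
    out the stage at which the turn ends. *)
Fixpoint alive pi u (k : nat) : bool :=
  if k is k'.+1 then alive pi u k' && ~~ turn_over pi u k' else true.

Definition bust g (x : R) : R := if x <= 1 then g x else 0.

(** The payoff secured strictly before stage k, with 0 while the turn is on: an approximation to [g]
    of the final score by functions of finitely many draws. *)
Fixpoint banked g pi u (k : nat) : R :=
  if k is k'.+1 then
    if alive pi u k' && turn_over pi u k' then bust g (total u k')
    else banked g pi u k'
  else 0.

Lemma aliveP pi u k :
  reflect (forall j, (j < k)%N -> ~~ turn_over pi u j) (alive pi u k).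
Proof.
elim: k => [|k IH] /=; first by constructor.
apply: (iffP andP) => [[/IH ak ok] j|H].
  by rewrite ltnS leq_eqVlt => /orP[/eqP ->//|]; exact: ak.
by split; [apply/IH => j jk; apply: H; exact: ltnW|exact: H].
Qed.

Lemma turn_score_first pi u k : alive pi u k -> turn_over pi u k ->
  turn_score pi u = bust id (total u k).
Proof.
move=> /aliveP ak ok; rewrite /turn_score; case: pselect => [e|ne]; last first.
  by exfalso; apply: ne; exists k.
case: ex_minnP => m om mmin.
suff -> : m = k by [].
apply/eqP; rewrite eqn_leq mmin//= leqNgt; apply/negP => mk.
by have := ak _ mk; rewrite om.
Qed.

Lemma turn_score_never pi u : (forall k, ~~ turn_over pi u k) -> turn_score pi u = 0.
Proof.
move=> H; rewrite /turn_score; case: pselect => // e; exfalso.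
by case: e => k; rewrite (negbTE (H k)).
Qed.

Lemma first_over pi u : (exists k, turn_over pi u k) ->
  exists k, alive pi u k /\ turn_over pi u k.
Proof.
move=> e; case: (ex_minnP e) => k ok kmin; exists k; split => //; apply/aliveP => j jk.
by apply/negP => oj; have := kmin _ oj; rewrite leqNgt jk.
Qed.

Lemma turn_score_le1 pi u : turn_score pi u <= 1.
Proof.
rewrite /turn_score; case: pselect => // e /=; first by case: ifP.
Qed.

Lemma banked_first g pi u k m : alive pi u k -> turn_over pi u k -> (k < m)%N ->
  banked g pi u m = bust g (total u k).
Proof.
move=> ak ok; elim: m => // m IH; rewrite ltnS leq_eqVlt => /orP[/eqP <- /=|km /=].
  by rewrite ak ok.
rewrite ifF ?IH//; apply/negP => /andP[/aliveP/(_ _ km)].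
by rewrite ok.
Qed.

Lemma banked_score g pi u k m : g 0 = 0 -> turn_over pi u k -> (k < m)%N ->
  banked g pi u m = g (turn_score pi u).
Proof.
move=> g0 ok km; have [j [aj oj]] : exists j, alive pi u j /\ turn_over pi u j.
  by apply: first_over; exists k.
have jk : (j <= k)%N.
  by rewrite leqNgt; apply/negP => kj; have /aliveP/(_ _ kj) := aj; rewrite ok.
rewrite (banked_first _ aj oj) ?(leq_ltn_trans jk)// (turn_score_first aj oj) /bust.
by case: ifP.
Qed.

Lemma alive_over pi u k m : turn_over pi u k -> (k < m)%N -> alive pi u m = false.
Proof. by move=> ok km; apply/negP => /aliveP /(_ _ km); rewrite ok. Qed.

Lemma banked_never g pi u m : (forall k, ~~ turn_over pi u k) -> banked g pi u m = 0.
Proof. by move=> H; elim: m => //= m ->; rewrite (negbTE (H m)) andbF. Qed.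

(** The sequence is eventually constant. On a turn that never ends it is 0 throughout, which is [g]
    at the conventional score 0. *)
Lemma banked_cvg g pi u : g 0 = 0 -> banked g pi u @ \oo --> g (turn_score pi u).
Proof.
move=> g0; have [[k ok]|ne] := pselect (exists k, turn_over pi u k).
  apply: cvg_near_cst; exists k.+1 => // m /= km.
  by rewrite (banked_score g0 ok km).
have H k : ~~ turn_over pi u k by apply/negP => ok; apply: ne; exists k.
rewrite turn_score_never// g0; apply: cvg_near_cst; exists 0%N => // m _ /=.
by rewrite banked_never.
Qed.

Lemma banked_range g pi u m : (forall x, 0 <= g x <= 1) -> 0 <= banked g pi u m <= 1.
Proof.
move=> g01; elim: m => [|m IH] /=; first by rewrite lexx ler01.
by case: ifP => // _; rewrite /bust; case: ifP => // _; rewrite lexx ler01.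
Qed.

End TurnScore.

(** * Measurability of the score of a turn *)

Section MeasurableTurn.
Context {R : realType} {d : measure_display} {T : measurableType d}.
Variables (D : T -> policy R) (v : nat -> T -> R).
Hypothesis mv : forall k, measurable_fun setT (v k).
Hypothesis mD : forall k, measurable_fun setT (fun x => D x (mkseq (v^~ x) k)).

Lemma measurable_total k : measurable_fun setT (fun x => total (v^~ x) k).
Proof. by rewrite /total; apply: measurable_sum => i; exact: mv. Qed.

Lemma measurable_turn_over k : measurable_fun setT (fun x => turn_over (D x) (v^~ x) k).
Proof.
rewrite /turn_over; case: (0 < k)%N => //=; apply: measurable_or => //.
by apply: measurable_fun_ltr => //; exact: measurable_total.
Qed.

Lemma measurable_alive k : measurable_fun setT (fun x => alive (D x) (v^~ x) k).
Proof.
elim: k => // k IH; apply: measurable_and => //.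
by apply: measurable_neg; exact: measurable_turn_over.
Qed.

Lemma measurable_bust (g : R -> R) : measurable_fun setT g -> measurable_fun setT (bust g).
Proof.
by move=> mg; apply: measurable_fun_ifT => //; apply: measurable_fun_ler.
Qed.

Lemma measurable_banked (g : R -> R) k : measurable_fun setT g ->
  measurable_fun setT (fun x => banked g (D x) (v^~ x) k).
Proof.
move=> mg; elim: k => // k IH /=; apply: measurable_fun_ifT => //.
  by apply: measurable_and; [exact: measurable_alive|exact: measurable_turn_over].
apply: measurableT_comp; [exact: measurable_bust|exact: measurable_total].
Qed.

(** The score is defined by a classical choice, but it is a pointwise limit of the measurable
    functions [banked id]. *)
Lemma measurable_turn_score : measurable_fun setT (fun x => turn_score (D x) (v^~ x)).
Proof.
apply: (measurable_fun_cvg (h := fun k x => banked id (D x) (v^~ x) k)).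
  by move=> k; exact: measurable_banked.
by move=> x _; exact: banked_cvg.
Qed.

End MeasurableTurn.

(** * Measurability of decisions along random draws *)

Section MeasurablePolicy.
Context {R : realType} {d : measure_display} {T : measurableType d}.
Variable v : nat -> T -> R.
Hypothesis mv : forall k, measurable_fun setT (v k).

Lemma mktuple_mkseq (f : nat -> R) k : tval [tuple f i | i < k] = mkseq f k.
Proof.
apply: (@eq_from_nth _ 0) => [|i]; rewrite size_tuple ?size_mkseq// => ik.
by rewrite nth_mkseq// -[i in LHS]/(val (Ordinal ik)) -tnth_nth tnth_mktuple.
Qed.

Lemma measurable_mktuple m (f : nat -> T -> R) : (forall k, measurable_fun setT (f k)) ->
  measurable_fun setT (fun x => [tuple f i x | i < m]).
Proof.
move=> mf; apply/measurable_fun_tnthP => i.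
by rewrite (_ : _ \o _ = f i)//; apply/funext => x /=; rewrite tnth_mktuple.
Qed.

Lemma measurable_policy_mkseq (pi : policy R) k : measurable_policy pi ->
  measurable_fun setT (fun x => pi (mkseq (v^~ x) k)).
Proof.
move=> mpi; rewrite (_ : (fun _ => _) =
   (fun t : k.-tuple R => pi t) \o (fun x => [tuple v i x | i < k])).
  by apply: (measurableT_comp (mpi k)); exact: measurable_mktuple.
by apply/funext => x /=; rewrite -mktuple_mkseq.
Qed.

Lemma measurable_profile_mkseq (sigma : profile R) (hist : T -> seq R) m k :
    measurable_profile sigma -> (forall x, size (hist x) = m) ->
    (forall j, measurable_fun setT (fun x => (hist x)`_j)) ->
  measurable_fun setT (fun x => sigma (hist x) (mkseq (v^~ x) k)).
Proof.
move=> msigma sm mh; rewrite (_ : (fun _ => _) =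
   (fun z : m.-tuple R * k.-tuple R => sigma z.1 z.2) \o
     (fun x => ([tuple (hist x)`_i | i < m], [tuple v i x | i < k]))).
  apply: (measurableT_comp (msigma m k)).
  apply: measurable_fun_pair; last exact: measurable_mktuple.
  exact: (measurable_mktuple mh).
apply/funext => x /=; rewrite -!mktuple_mkseq; congr (sigma _ _).
rewrite (mktuple_mkseq (fun i => nth 0 (hist x) i)).
by apply: (@eq_from_nth _ 0); rewrite ?size_mkseq// => i; rewrite sm => im; rewrite nth_mkseq.
Qed.

End MeasurablePolicy.

(** * Dependence of each stage on the earlier draws only *)

Section Agree.
Context {R : realType}.
Variables (pi : policy R) (u u' : nat -> R) (k : nat).
Hypothesis uu' : forall j, (j < k)%N -> u j = u' j.

Lemma total_agree j : (j <= k)%N -> total u j = total u' j.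
Proof. by move=> jk; apply: eq_bigr => i _; apply: uu'; exact: leq_trans jk. Qed.

Lemma turn_over_agree j : (j <= k)%N -> turn_over pi u j = turn_over pi u' j.
Proof.
move=> jk; rewrite /turn_over (total_agree jk); congr (_ && (_ || pi _)).
apply: (@eq_from_nth _ 0); rewrite !size_mkseq// => i ij.
by rewrite !nth_mkseq//; apply: uu'; exact: leq_trans jk.
Qed.

Lemma alive_agree j : (j <= k)%N -> alive pi u j = alive pi u' j.
Proof.
by elim: j => //= j IH jk; rewrite IH 1?ltnW// turn_over_agree// ltnW.
Qed.

Lemma banked_agree g j : (j <= k)%N -> banked g pi u j = banked g pi u' j.
Proof.
elim: j => //= j IH jk; have jk' := ltnW jk.
by rewrite IH// turn_over_agree// alive_agree// total_agree.
Qed.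

End Agree.

(** * Averages over one uniform draw *)

Definition spin {R : realType} (F : R -> R) (x : R) : R :=
  \int[lebesgue_measure]_(t in `[0, 1]) F (x + t).

Section Uniform.
Context {R : realType} {d : measure_display} {Omega : measurableType d}.
Variable P : probability Omega R.

Lemma integral_uniform_RV (X : {RV P >-> R}) (f : R -> \bar R) :
    (forall B, measurable B -> distribution P X B = uniform_prob (@ltr01 R) B) ->
    measurable_fun setT f -> (forall x, 0 <= f x)%E ->
  (\int[P]_w f (X w) = \int[lebesgue_measure]_(t in `[0%R, 1%R]) f t)%E.
Proof.
move=> uX mf f0.
have := integral_uniform (@ltr01 R) mf f0; rewrite subr0 invr1 mul1e => <-.
have mX : @measurable_fun _ _ Omega (measurableTypeR R) setT X.
  exact: (measurable_funPT X).
pose X' : {mfun Omega >-> measurableTypeR R} :=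
  HB.pack (X : Omega -> measurableTypeR R) (isMeasurableFun.Build _ _ _ _ _ mX).
rewrite (eq_measure_integral (distribution P X')); last first.
  by move=> A mA _; exact/esym/uX.
by rewrite ge0_integral_pushforward//= preimage_setT.
Qed.

Lemma integrable_bounded_itv (f : R -> R) : measurable_fun setT f ->
  (forall x, 0 <= f x <= 1) -> lebesgue_measure.-integrable `[0, 1] (EFin \o f).
Proof.
move=> mf f01; apply: (@le_integrable _ _ _ _ _ _ _ (cst 1%E)) => //=.
- by apply/measurable_EFinP; exact: measurable_funTS.
- move=> x _; rewrite lee_fin; have /andP[f0 f1] := f01 x.
  by rewrite ger0_norm// normr1.
- apply/integrableP; split => //.
  rewrite integral_cst//= lebesgue_measure_itv/= lte_fin ltr01 /=.
  by rewrite normr1 -EFinB -EFinM ltry.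
Qed.

Lemma spinE (X : {RV P >-> R}) (F : R -> R) x :
    (forall B, measurable B -> distribution P X B = uniform_prob (@ltr01 R) B) ->
    measurable_fun setT F -> (forall x, 0 <= F x <= 1) ->
  (\int[P]_w (F (x + X w))%:E = (spin F x)%:E)%E.
Proof.
move=> uX mF F01.
have mFx : measurable_fun setT (fun t => F (x + t)).
  by apply: measurableT_comp => //; exact: measurable_funD.
rewrite (integral_uniform_RV uX (f := fun t => (F (x + t))%:E)); first last.
- by move=> t; rewrite lee_fin; case/andP: (F01 (x + t)).
- exact/measurable_EFinP.
rewrite /spin /Rintegral fineK//.
by apply: integrable_fin_num => //; exact: integrable_bounded_itv.
Qed.

(** Written as an integral over the sample space, [spin F] is a partial integral of a jointly
    measurable function, and Tonelli applies. *)
Lemma measurable_spin (X : {RV P >-> R}) (F : R -> R) :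
    (forall B, measurable B -> distribution P X B = uniform_prob (@ltr01 R) B) ->
    measurable_fun setT F -> (forall x, 0 <= F x <= 1) ->
  measurable_fun setT (spin F).
Proof.
move=> uX mF F01; apply/measurable_EFinP.
rewrite (_ : _ \o _ = fubini_F P (fun z : R * Omega => (F (z.1 + X z.2))%:E)).
  apply: measurable_fun_fubini_tonelli_F.
    apply/measurable_EFinP; apply: measurableT_comp => //.
    by apply: measurable_funD => //; apply: measurableT_comp.
  by move=> z; rewrite lee_fin; case/andP: (F01 (z.1 + X z.2)).
by apply/funext => x; rewrite /= /fubini_F /= spinE.
Qed.

End Uniform.

(** * The bust probability and theta *)

Section BustProb.
Context {R : realType}.
Local Notation leb := lebesgue_measure.

Definition bust_prob (x : R) : R := 1 - expR x + x * expR x.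

Lemma bust_probE x : bust_prob x = 1 - (1 - x) * expR x.
Proof. by rewrite /bust_prob; ring. Qed.

Lemma bust_prob1 : bust_prob 1 = 1.
Proof. by rewrite bust_probE subrr mul0r subr0. Qed.

Lemma bust_prob0 : bust_prob 0 = 0.
Proof. by rewrite bust_probE expR0; ring. Qed.

(** After division by e^y the claim is 1 - y < (1 - x) e^(x - y). It follows from e^z > 1 + z,
    because (1 - x)(1 + x - y) - (1 - y) = x (y - x) >= 0. *)
Lemma bust_prob_lt x y : 0 <= x -> x < y -> y <= 1 -> bust_prob x < bust_prob y.
Proof.
move=> x0 xy y1; rewrite !bust_probE ltrD2l ltrN2.
have e : 1 + (x - y) < expR (x - y) by apply: expR_gt1Dx; lra.
rewrite (_ : expR x = expR (x - y) * expR y); last by rewrite -expRD subrK.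
rewrite mulrA ltr_pM2r ?expR_gt0//.
have : (1 - x) * (1 + (x - y)) < (1 - x) * expR (x - y).
  by rewrite ltr_pM2l//; lra.
apply: le_lt_trans; nra.
Qed.

Lemma bust_prob_le x y : 0 <= x -> x <= y -> y <= 1 -> bust_prob x <= bust_prob y.
Proof.
by move=> x0; rewrite le_eqVlt => /predU1P[->//|xy y1]; exact/ltW/bust_prob_lt.
Qed.

Lemma bust_prob_ge0 x : 0 <= x -> x <= 1 -> 0 <= bust_prob x.
Proof. by move=> x0 x1; rewrite -bust_prob0 bust_prob_le. Qed.

Lemma bust_prob_le1 x : 0 <= x -> x <= 1 -> bust_prob x <= 1.
Proof. by move=> x0 x1; rewrite -[leRHS]bust_prob1 bust_prob_le. Qed.

Lemma bust_prob_gt0 x : 0 < x -> x <= 1 -> 0 < bust_prob x.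
Proof. by move=> x0 x1; rewrite -bust_prob0 bust_prob_lt. Qed.

Lemma continuous_bust_prob m : continuous (fun x => bust_prob x ^+ m).
Proof.
move=> x; apply: (@continuous_comp _ _ _ bust_prob (fun y => y ^+ m)); last exact: exprn_continuous.
apply: cvgD; first by apply: cvgB; [exact: cvg_cst|exact: continuous_expR].
by apply: cvgM => //; exact: continuous_expR.
Qed.

Lemma integrable_continuous (f : R -> R) a b : continuous f ->
  leb.-integrable `[a, b] (EFin \o f).
Proof.
move=> cf; apply: continuous_compact_integrable; first exact: segment_compact.
exact: continuous_subspaceT.
Qed.

(** The right side of the theta equation; also the expected payoff of exactly one more spin from x
    when stopping at a larger total t <= 1 pays Q(t)^m. *)
Definition bust_integral m (x : R) : R := \int[leb]_(t in `[x, 1]) (bust_prob t ^+ m).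

Lemma theta_equationE r (x : R) :
  theta_equation r x = (bust_prob x ^+ r.-1 = bust_integral r.-1 x).
Proof. by []. Qed.

Lemma bust_integral1 m : bust_integral m 1 = 0.
Proof. by rewrite /bust_integral set_itv1 Rintegral_set1. Qed.

Lemma Rintegral_itv_split (f : R -> R) a b c : a <= b -> b <= c ->
  leb.-integrable `[a, c] (EFin \o f) ->
  \int[leb]_(t in `[a, c]) f t = \int[leb]_(t in `[a, b]) f t + \int[leb]_(t in `[b, c]) f t.
Proof.
move=> ab bc fi; have := Rintegral_itvB fi (x := b); rewrite !bnd_simp => /(_ ab bc).
rewrite Rintegral_itv_obnd_cbnd => [<-|]; first by rewrite addrC subrK.
apply: integrableS fi => // t; rewrite /= !in_itv /= => /andP[bt ->].
by rewrite andbT (le_trans ab)// ltW.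
Qed.

Lemma bust_integral_split m x y : x <= y -> y <= 1 ->
  bust_integral m x = \int[leb]_(t in `[x, y]) (bust_prob t ^+ m) + bust_integral m y.
Proof.
move=> xy y1; apply: Rintegral_itv_split => //.
exact: integrable_continuous (@continuous_bust_prob m).
Qed.

Lemma bust_integral_ge0 m x : 0 <= x -> 0 <= bust_integral m x.
Proof.
move=> x0; apply: Rintegral_ge0 => t; rewrite /= in_itv /= => /andP[xt t1].
by rewrite exprn_ge0// bust_prob_ge0// (le_trans x0).
Qed.

Lemma Rintegral_itv_le m x y : 0 <= x -> x <= y -> y <= 1 ->
  \int[leb]_(t in `[x, y]) (bust_prob t ^+ m) <= (y - x) * bust_prob y ^+ m.
Proof.
move=> x0 xy y1; have -> : (y - x) * bust_prob y ^+ m =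
    \int[leb]_(t in `[x, y]) (bust_prob y ^+ m).
  rewrite Rintegral_cst//= lebesgue_measure_itv /= lte_fin mulrC; congr (_ * _).
  by case: ltP => [|yx]/=; first by []; lra.
apply: le_Rintegral => //.
- exact: integrable_continuous (@continuous_bust_prob m).
- by apply: integrable_continuous => t; exact: cvg_cst.
- move=> t; rewrite /= in_itv /= => /andP[xt ty].
  rewrite lerXn2r// ?nnegrE ?bust_prob_ge0 ?bust_prob_le//; lra.
Qed.

Lemma Rintegral_itv_ge m x y : 0 <= x -> x <= y -> y <= 1 ->
  (y - x) * bust_prob x ^+ m <= \int[leb]_(t in `[x, y]) (bust_prob t ^+ m).
Proof.
move=> x0 xy y1; have -> : (y - x) * bust_prob x ^+ m =
    \int[leb]_(t in `[x, y]) (bust_prob x ^+ m).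
  rewrite Rintegral_cst//= lebesgue_measure_itv /= lte_fin mulrC; congr (_ * _).
  by case: ltP => [|yx]/=; first by []; lra.
apply: le_Rintegral => //.
- by apply: integrable_continuous => t; exact: cvg_cst.
- exact: integrable_continuous (@continuous_bust_prob m).
- move=> t; rewrite /= in_itv /= => /andP[xt ty].
  rewrite lerXn2r// ?nnegrE ?bust_prob_ge0 ?bust_prob_le//; lra.
Qed.

Lemma bust_integral_le m x : 0 <= x -> x <= 1 -> bust_integral m x <= 1 - x.
Proof.
move=> x0 x1; have := Rintegral_itv_le m x0 x1 (lexx 1).
by rewrite bust_prob1 expr1n mulr1.
Qed.

Lemma bust_integral_lt m x y : 0 <= x -> x < y -> y <= 1 -> bust_integral m y < bust_integral m x.
Proof.
move=> x0 xy y1; rewrite (bust_integral_split m (ltW xy) y1).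
suff : 0 < \int[leb]_(t in `[x, y]) (bust_prob t ^+ m) by lra.
have c : leb.-integrable `[x, y] (EFin \o (fun t => bust_prob t ^+ m)).
  exact: integrable_continuous (@continuous_bust_prob m).
(* Q vanishes at 0, so the lower bound by the value at the left endpoint may be 0; on the right half
   of the interval the left endpoint is positive. *)
rewrite (@Rintegral_itv_split _ x ((x + y) / 2) y)//; [|lra|lra].
have a0 : 0 <= x <= (x + y) / 2 by apply/andP; split; lra.
have b0 : (x + y) / 2 <= y by lra.
have c0 : 0 <= (x + y) / 2 by lra.
have := Rintegral_itv_ge m c0 b0 y1.
case/andP: a0 => a0 a1.
have := Rintegral_itv_ge m a0 a1 (le_trans b0 y1).
have : 0 <= ((x + y) / 2 - x) * bust_prob x ^+ m.
  by apply: mulr_ge0; [lra|apply: exprn_ge0; apply: bust_prob_ge0; lra].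
have : 0 < (y - (x + y) / 2) * bust_prob ((x + y) / 2) ^+ m.
  by apply: mulr_gt0; [lra|apply: exprn_gt0; apply: bust_prob_gt0; lra].
lra.
Qed.

(** Its zeros in [0, 1] are the solutions of the theta equation. It is strictly increasing there, so
    its sign tells on which side of theta a point lies. *)
Definition theta_gap m x := bust_prob x ^+ m - bust_integral m x.

Lemma theta_gap_lt m x y : 0 <= x -> x < y -> y <= 1 -> theta_gap m x < theta_gap m y.
Proof.
move=> x0 xy y1; rewrite /theta_gap.
have : bust_prob x ^+ m <= bust_prob y ^+ m.
  by rewrite lerXn2r// ?nnegrE ?bust_prob_ge0 ?bust_prob_le//; lra.
have := bust_integral_lt m x0 xy y1; lra.
Qed.

Lemma continuous_theta_gap m : {within `[0, 1], continuous (theta_gap m)}.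
Proof.
have c := @integrable_continuous _ 0 1 (@continuous_bust_prob m).
have H := parameterized_integral_continuous (@ler01 R) c.
(* The variable lower bound is traded for a variable upper bound: the integral from x to 1 is the
   integral from 0 to 1 minus the one from 0 to x. *)
apply: (@subspace_eq_continuous _ _ _ (fun x => bust_prob x ^+ m -
    (bust_integral m 0 - parameterized_integral leb 0 x (fun t => bust_prob t ^+ m)))).
  move=> x; rewrite inE /= in_itv /= => /andP[x0 x1].
  by rewrite /theta_gap /= (bust_integral_split m x0 x1) /parameterized_integral
    /from_subspace; ring.
move=> x; apply: cvgB; first exact: (continuous_subspaceT (@continuous_bust_prob m)).
by apply: cvgB; [exact: cvg_cst|exact: H].
Qed.

Lemma theta_exists m : exists2 x : R, 0 <= x <= 1 & bust_prob x ^+ m = bust_integral m x.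
Proof.
have : exists2 c, c \in `[0, 1] & theta_gap m c = 0.
  apply: IVT => //; first exact: continuous_theta_gap.
  rewrite ge_min le_max; apply/andP; split; apply/orP; [left|right].
    rewrite /theta_gap; case: m => [|m]; last first.
      by rewrite bust_prob0 expr0n /= sub0r oppr_le0 bust_integral_ge0.
    (* For exponent 0 the convention 0^0 = 1 makes the gap at 0 equal to 1 - 1. *)
    suff : bust_integral 0 0 = 1 by move=> ->; rewrite expr0 subrr.
    transitivity (\int[leb]_(t in `[0, 1]) (1 : R)).
      by apply: eq_Rintegral => t _; rewrite expr0.
    by rewrite Rintegral_cst//= lebesgue_measure_itv /= lte_fin ltr01 /= mul1r subr0.
  by rewrite /theta_gap bust_integral1 bust_prob1 expr1n subr0 ler01.
by move=> [c]; rewrite in_itv => c01 /eqP; rewrite subr_eq0 => /eqP; exists c.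
Qed.

(** Existence of a solution ensures that the [xget] in [theta] returns a genuine root and not merely
    its default value. *)
Lemma theta_spec r : 0 <= (theta r : R) <= 1 /\
  bust_prob (theta r : R) ^+ r.-1 = bust_integral r.-1 (theta r).
Proof.
rewrite /theta; case: xgetP => [x _ [x01 /=]|]; first by rewrite theta_equationE.
by have [x x01 xe] := theta_exists r.-1 => /(_ x) []; split.
Qed.

Lemma theta_ge0 r : 0 <= theta r :> R.
Proof. by case: (theta_spec r) => /andP[]. Qed.

Lemma theta_le1 r : theta r <= 1 :> R.
Proof. by case: (theta_spec r) => /andP[]. Qed.

Lemma theta_lt1 r : theta r < 1 :> R.
Proof.
rewrite lt_neqAle theta_le1 andbT; apply/eqP => e.
have [_] := theta_spec r; rewrite e bust_prob1 bust_integral1 expr1n => /eqP.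
by rewrite oner_eq0.
Qed.

Lemma bust_integral_le_bust_prob r x : theta r <= x -> x <= 1 ->
  bust_integral r.-1 x <= bust_prob x ^+ r.-1.
Proof.
rewrite le_eqVlt => /predU1P[<- _|tx x1]; first by have [_ ->] := theta_spec r.
have := theta_gap_lt r.-1 (theta_ge0 r) tx x1; rewrite /theta_gap.
by have [_ ->] := theta_spec r; lra.
Qed.

Lemma bust_integral_lt_bust_prob r x : theta r < x -> x <= 1 ->
  bust_integral r.-1 x < bust_prob x ^+ r.-1.
Proof.
move=> tx x1.
have := theta_gap_lt r.-1 (theta_ge0 r) tx x1; rewrite /theta_gap.
by have [_ ->] := theta_spec r; lra.
Qed.

(** Let t be the root for exponent r. Since Q(t) <= Q on [t, 1], Q(t)^(r+1) = Q(t) int_t^1 Q^r <=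
    int_t^1 Q^(r+1). The gap for exponent r + 1 is thus nonpositive at t, so t cannot lie to the
    right of its root. *)
Lemma thetaS r : theta r.+1 <= theta r.+2 :> R.
Proof.
rewrite leNgt; apply/negP => lt.
have [/andP[t0 t1] te] := theta_spec r.+1.
have := bust_integral_lt_bust_prob lt t1; rewrite ltNge => /negP; apply.
rewrite /= exprS -[X in _ * X]/(bust_prob (theta r.+1) ^+ r.+1.-1) te /bust_integral /=.
rewrite -RintegralZl//; last exact: integrable_continuous (@continuous_bust_prob r).
apply: le_Rintegral => //.
- apply: integrable_continuous => t; apply: cvgM; first exact: cvg_cst.
  exact: continuous_bust_prob.
- exact: integrable_continuous (@continuous_bust_prob r.+1).
- move=> t; rewrite /= in_itv /= => /andP[xt ty]; rewrite exprS.
  rewrite ler_wpM2r// ?bust_prob_le//; apply: exprn_ge0; apply: bust_prob_ge0 => //; lra.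
Qed.

Lemma theta_le j r : (0 < j)%N -> (j <= r)%N -> theta j <= theta r :> R.
Proof.
case: j => // j _; elim: r => // r IH; rewrite leq_eqVlt => /predU1P[->//|].
rewrite ltnS => jr; apply: le_trans (IH jr) _; case: r {IH} jr => // r _; exact: thetaS.
Qed.

End BustProb.

(** * The value of continuing up to a threshold *)

Section Spin.
Context {R : realType}.
Local Notation leb := lebesgue_measure.

(** Lebesgue measure is determined by its values on half-open intervals, whose lengths translation
    preserves. *)
Lemma lebesgue_measure_translation (c : R) (A : set R) : measurable A ->
  pushforward leb ((fun t => c + t) : _ -> measurableTypeR R) A = leb A.
Proof.
have mc : @measurable_fun _ _ (measurableTypeR R) (measurableTypeR R) setT (fun t => c + t).
  exact: measurable_funD.
pose T : {mfun measurableTypeR R >-> measurableTypeR R} :=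
  HB.pack (fun t : measurableTypeR R => c + t : measurableTypeR R)
    (isMeasurableFun.Build _ _ _ _ _ mc).
move=> mA; apply/esym; apply: (@lebesgue_measure_unique R (pushforward leb T)) => //=
  _ [[a b]] _ <-.
rewrite /pushforward.
have -> : (fun t => c + t) @^-1` `]a, b] = `]a - c, b - c]%classic.
  apply/seteqP; split => t; rewrite /= !in_itv /= => /andP[h1 h2]; apply/andP; split; lra.
rewrite !lebesgue_measure_itv/= !lte_fin ltrD2r; case: ifP => // _.
by congr EFin; ring.
Qed.

(** Translation turns the average over a draw into an integral over [x, x + 1], which can then be
    split at kappa and at 1. *)
Lemma spin_shift (F : R -> R) x : measurable_fun setT F -> (forall y, 0 <= F y) ->
  spin F x = \int[leb]_(t in `[x, x + 1]) F t.
Proof.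
move=> mF F0; rewrite /spin /Rintegral; congr fine.
have mx : @measurable_fun _ _ (measurableTypeR R) (measurableTypeR R) setT (fun t => x + t).
  exact: measurable_funD.
pose T : {mfun measurableTypeR R >-> measurableTypeR R} :=
  HB.pack (fun t : measurableTypeR R => x + t : measurableTypeR R)
    (isMeasurableFun.Build _ _ _ _ _ mx).
rewrite (_ : `[0, 1]%classic = T @^-1` `[x, x + 1]); last first.
  by apply/seteqP; split => t; rewrite /= !in_itv /= => /andP[h1 h2]; apply/andP; split; lra.
transitivity (\int[pushforward leb T]_(t in `[x, (x + 1)%R]) (F t)%:E)%E.
  rewrite ge0_integral_pushforward//=.
  - by apply/measurable_EFinP; exact: measurable_funS mF.
  - by move=> y _; rewrite lee_fin.
by apply: eq_measure_integral => A mA _; exact: lebesgue_measure_translation.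
Qed.

Variables (m : nat) (kappa : R).
Hypothesis kappa01 : 0 <= kappa <= 1.

(* The value of the state [x] for a player who continues until his total
   exceeds [kappa] and is then paid [bust_prob ^+ m]; the value 1 at the
   unreachable negative totals makes it superharmonic everywhere. *)
Definition cont_value (x : R) : R :=
  if x < 0 then 1
  else if x <= kappa then expR (kappa - x) * bust_integral m kappa
  else if x <= 1 then bust_prob x ^+ m else 0.

Lemma cont_value_range x : 0 <= cont_value x <= 1.
Proof.
have /andP[k0 k1] := kappa01.
rewrite /cont_value; case: (ltP x 0) => x0; first by apply/andP; split.
case: (leP x kappa) => xk; last first.
  case: (leP x 1) => x1; last by rewrite lexx ler01.
  by rewrite exprn_ge0 ?exprn_ile1 ?bust_prob_ge0 ?bust_prob_le1.
rewrite mulr_ge0 ?expR_ge0 ?bust_integral_ge0//=.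
have := bust_integral_le m k0 k1 => t1; have t0 := bust_integral_ge0 m k0.
have e : expR (kappa - x) <= expR kappa by rewrite ler_expR; lra.
have e0 := expR_ge0 kappa.
(* The intermediate bound (1 - kappa) e^kappa equals 1 - Q(kappa), hence is at most 1. *)
apply: (@le_trans _ _ (expR kappa * (1 - kappa))).
  by apply: ler_pM => //; exact: expR_ge0.
have := bust_prob_ge0 k0 k1; rewrite bust_probE; lra.
Qed.

Lemma cont_value_bust x : 1 < x -> cont_value x = 0.
Proof.
have /andP[k0 k1] := kappa01.
by move=> x1; rewrite /cont_value !ifF//; apply/negbTE; rewrite -?ltNge -?leNgt; lra.
Qed.

Lemma cont_value_gt x : kappa < x -> x <= 1 -> cont_value x = bust_prob x ^+ m.
Proof.
have /andP[k0 k1] := kappa01.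
move=> kx x1; rewrite /cont_value x1.
have -> : (x < 0) = false by apply/negbTE; rewrite -leNgt; lra.
by have -> : (x <= kappa) = false by apply/negbTE; rewrite -ltNge.
Qed.

Lemma cont_value_le x : 0 <= x -> x <= kappa ->
  cont_value x = expR (kappa - x) * bust_integral m kappa.
Proof. by move=> x0 xk; rewrite /cont_value ltNge x0 xk. Qed.

Lemma measurable_cont_value : measurable_fun setT cont_value.
Proof.
apply: measurable_fun_ifT => //; first exact: measurable_fun_ltr.
apply: measurable_fun_ifT; first exact: measurable_fun_ler.
  apply: measurable_funM => //; apply: measurableT_comp; first exact: measurable_expR.
  exact: measurable_funB.
apply: measurable_fun_ifT => //; first exact: measurable_fun_ler.
by apply: continuous_measurable_fun; exact: continuous_bust_prob.
Qed.

Lemma integrable_cont_value a b : leb.-integrable `[a, b] (EFin \o cont_value).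
Proof.
apply: (@le_integrable _ _ _ _ _ _ _ (cst 1%E)) => //=.
- by apply/measurable_EFinP; exact: measurable_funS measurable_cont_value.
- move=> x _; rewrite lee_fin; have /andP[f0 f1] := cont_value_range x.
  by rewrite ger0_norm// normr1.
- apply/integrableP; split => //.
  rewrite integral_cst//= lebesgue_measure_itv/=.
  by case: ifP => _; rewrite normr1 ?mule0 ?ltry// -EFinB -EFinM ltry.
Qed.

Lemma Rintegral_cont_value_gt x : kappa < x -> x <= 1 ->
  \int[leb]_(t in `[x, 1]) cont_value t = bust_integral m x.
Proof.
have /andP[k0 k1] := kappa01.
move=> kx x1; apply: eq_Rintegral => t; rewrite inE /= in_itv /= => /andP[xt t1].
by rewrite cont_value_gt//; lra.
Qed.

(** At kappa itself [cont_value] takes its exponential branch, which may differ from Q^m; this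
    endpoint is a null set and is removed first. *)
Lemma Rintegral_cont_value_kappa :
  \int[leb]_(t in `[kappa, 1]) cont_value t = bust_integral m kappa.
Proof.
have /andP[k0 k1] := kappa01.
rewrite /bust_integral -!Rintegral_itv_obnd_cbnd.
- apply: eq_Rintegral => t; rewrite inE /= in_itv /= => /andP[xt t1].
  by rewrite cont_value_gt//; lra.
- apply: integrableS (integrable_continuous _ _ (@continuous_bust_prob _ m)) => //.
  by apply: subset_itvr; rewrite bnd_simp.
- apply: integrableS (integrable_cont_value _ _) => //.
  by apply: subset_itvr; rewrite bnd_simp.
Qed.

Lemma Rintegral_cont_value_bust x : 1 <= x ->
  \int[leb]_(t in `[1, x]) cont_value t = 0.
Proof.
move=> x1; rewrite -Rintegral_itv_obnd_cbnd; last first.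
  apply: integrableS (integrable_cont_value 1 x) => //.
  by apply: subset_itvr; rewrite bnd_simp.
transitivity (\int[leb]_(t in `]1, x]) (0 : R)).
  by apply: eq_Rintegral => t; rewrite inE /= in_itv /= => /andP[t1 _]; rewrite cont_value_bust.
by rewrite Rintegral_cst// mul0r.
Qed.

Lemma Rintegral_expR (c a b : R) : a <= b ->
  \int[leb]_(t in `[a, b]) (expR (b - t) * c) = (expR (b - a) - 1) * c.
Proof.
rewrite le_eqVlt => /predU1P[->|ab].
  by rewrite set_itv1 Rintegral_set1 subrr expR0 subrr mul0r.
pose G (t : R) := - (expR (b - t) * c).
have dG (t : R) : is_derive t 1 G (expR (b - t) * c).
  rewrite /G; apply: is_derive_eq; rewrite /GRing.scale /=; ring.
have cG : continuous G.
  by move=> t; apply: differentiable_continuous; apply/derivable1_diffP.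
rewrite /Rintegral (@continuous_FTC2 _ _ G)//.
- by rewrite /G -EFinB /= subrr expR0; ring.
- apply: continuous_subspaceT => t; apply: cvgM; last exact: cvg_cst.
  apply: (@continuous_comp _ _ _ (fun t => b - t) expR); last exact: continuous_expR.
  by apply: cvgB => //; exact: cvg_cst.
- split => //.
  + exact/cvg_at_right_filter/cG.
  + exact/cvg_at_left_filter/cG.
- by move=> t _; rewrite derive1E derive_val.
Qed.

(** On [0, kappa] the function solves F(x) = int_x^1 F, that is F' = -F with value int_kappa^1 Q^m
    at kappa: continuing is a fair step. *)
Lemma spin_cont_value_le x : 0 <= x -> x <= kappa -> spin cont_value x = cont_value x.
Proof.
have /andP[k0 k1] := kappa01.
move=> x0 xk; rewrite spin_shift; last 2 first.
- exact: measurable_cont_value.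
- by move=> y; case/andP: (cont_value_range y).
rewrite (@Rintegral_itv_split _ _ x 1 (x + 1)); [|lra|lra|exact: integrable_cont_value].
rewrite Rintegral_cont_value_bust ?addr0; last lra.
rewrite (@Rintegral_itv_split _ _ x kappa 1)//; last exact: integrable_cont_value.
rewrite Rintegral_cont_value_kappa.
transitivity (\int[leb]_(t in `[x, kappa]) (expR (kappa - t) * bust_integral m kappa) +
    bust_integral m kappa).
  congr (_ + _); apply: eq_Rintegral => t; rewrite inE /= in_itv /= => /andP[xt t1].
  by rewrite cont_value_le//; lra.
by rewrite Rintegral_expR// cont_value_le//; ring.
Qed.

(** Beyond kappa every total reached without a bust is on the stopping branch, and a bust pays 0, so
    only a single spin followed by a stop is averaged. *)
Lemma spin_cont_value_gt x : kappa < x -> x <= 1 -> spin cont_value x = bust_integral m x.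
Proof.
have /andP[k0 k1] := kappa01.
move=> xk x1; rewrite spin_shift; last 2 first.
- exact: measurable_cont_value.
- by move=> y; case/andP: (cont_value_range y).
rewrite (@Rintegral_itv_split _ _ x 1 (x + 1))//; [|lra|exact: integrable_cont_value].
by rewrite Rintegral_cont_value_bust ?addr0 ?Rintegral_cont_value_gt//; lra.
Qed.

End Spin.

(** * Totals of independent uniform draws *)

Section Process.
Context {R : realType} {d : measure_display} {Omega : measurableType d}.
Variable P : probability Omega R.
Variable u : nat -> {RV P >-> R}.
Hypothesis unif_u : forall k B, measurable B ->
  distribution P (u k) B = uniform_prob (@ltr01 R) B.
Hypothesis indep_u : mutually_independent u.

Definition draws (w : Omega) : nat -> R := fun k => u k w.

Lemma total_draws0 w : total (draws w) 0 = 0.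
Proof. by rewrite /total big_ord0. Qed.

Lemma totalS (v : nat -> R) k : total v k.+1 = total v k + v k.
Proof. by rewrite /total big_ord_recr. Qed.

Lemma draws_range : \forall w \ae P, forall k, 0 <= draws w k <= 1.
Proof.
apply: ae_foralln => k.
exists (u k @^-1` (~` `[0, 1])); split.
- by apply: measurable_funPTI; exact: measurableC.
- have /= := unif_u k (measurableC (measurable_itv `[(0:R), 1])).
  rewrite /distribution /pushforward /= => ->.
  by rewrite /uniform_prob integral_uniform_pdf setICl integral_set0.
- by move=> w /= H; move=> K; apply: H; move: K; rewrite /= in_itv.
Qed.

Lemma total_ge0 : \forall w \ae P, forall k, 0 <= total (draws w) k.
Proof.
apply: filterS draws_range => w H k; apply: sumr_ge0 => i _.
by case/andP: (H i).
Qed.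

Definition past (k : nat) : set nat := [set j | (j < k)%N].

(** Later draws are replaced by 0, which gives a full sequence, as the measurability lemmas on turns
    require, that depends on the first k draws only. *)
Definition past_draws k j (w : Omega) : R := if (j < k)%N then u j w else 0.

Lemma measurable_past_draws k j :
  @measurable_fun _ _ (sigma_of u (past k)) R setT (past_draws k j).
Proof.
rewrite /past_draws; case: ltnP => // jk; exact: (measurable_sigma_of (i := j)).
Qed.

Lemma past_drawsE k w j : (j < k)%N -> past_draws k j w = draws w j.
Proof. by rewrite /past_draws => ->. Qed.

Lemma indep_next k (f : sigma_of u (past k) * R -> \bar R) :
    measurable_fun setT f -> (forall z, 0 <= f z)%E ->
  (\int[P]_w f (w, u k w) = \int[P]_w \int[P]_w' f (w, u k w'))%E.
Proof.
move=> mf f0.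
apply: (@indep_pair_integral _ _ _ P _ _ (sigma_of u (past k)) R (fun w => w) (u k)) => //.
  exact: measurable_id_sigma_of.
move=> A B mA mB; apply: (indep_sigma indep_u (J1 := past k) (J2 := [set k])) => //.
- by apply/seteqP; split => // j [/= jk ej]; move: jk; rewrite ej /past /= ltnn.
- have := measurable_sigma_of (X := u) (J := [set k]) (i := k) erefl measurableT mB.
  by rewrite setTI.
Qed.

(** Given the first k draws, the next one would have to hit a single point. This disposes of totals
    equal to the threshold, where a policy is unrestricted, and of totals equal to 1. *)
Lemma total_neq k (c : R) : \forall w \ae P, total (draws w) k.+1 != c.
Proof.
pose f (z : sigma_of u (past k) * R) : \bar R :=
  ((\1_[set c] (total (past_draws k ^~ z.1) k + z.2) : R))%:E.
have mf : measurable_fun setT f.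
  apply/measurable_EFinP; apply: measurableT_comp; first exact: measurable_indic.
  apply: measurable_funD => //.
  apply: (measurableT_comp (f := fun w : sigma_of u (past k) =>
    total (past_draws k ^~ w) k)) => //.
  by apply: measurable_total => j; exact: measurable_past_draws.
have f0 z : (0 <= f z)%E by rewrite lee_fin.
have E w j : (j <= k)%N -> total (past_draws k ^~ w) j = total (draws w) j.
  by move=> jk; apply: total_agree jk => i ik; exact: past_drawsE.
have mc : measurable [set w | total (draws w) k.+1 = c].
  rewrite (_ : [set _ | _] = (fun w => total (draws w) k.+1) @^-1` [set c])//.
  rewrite -[X in measurable X]setTI.
  by apply: measurable_total => // j; exact: measurable_funPT.
have := indep_next mf f0.
have -> : (\int[P]_w f (w, u k w) = P [set w | total (draws w) k.+1 = c])%E.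
  transitivity (\int[P]_w (\1_[set w | total (draws w) k.+1 = c] w)%:E)%E.
    apply: eq_integral => w _; rewrite /f /= E// !indicE; congr (_%:R%:E).
    by congr nat_of_bool; apply/idP/idP; rewrite !inE /= totalS.
  by rewrite integral_indic// setIT.
rewrite (eq_integral (cst 0%E)); last first.
  move=> w _; transitivity (\int[P]_w' (\1_(u k @^-1` [set c - total (draws w) k]) w')%:E)%E.
    apply: eq_integral => w' _; rewrite /f /= E// !indicE; congr (_%:R%:E).
    congr nat_of_bool; apply/idP/idP; rewrite !inE /= => e; lra.
  rewrite integral_indic// setIT.
  have := unif_u k (measurable_set1 (c - total (draws w) k)).
  rewrite /distribution /pushforward /= => ->.
  have /null_content_dominatesP H := dominates_uniform_prob (@ltr01 R).
  by apply: H => //; exact: lebesgue_measure_set1.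
rewrite integral0 => P0.
exists [set w | total (draws w) k.+1 = c]; split => //.
by move=> w /= /negP; rewrite negbK => /eqP.
Qed.

Lemma uniform_prob_half : uniform_prob (@ltr01 R) `]-oo, 1/2] = (1/2)%:E.
Proof.
rewrite /uniform_prob integral_uniform_pdf.
rewrite (_ : _ `&` _ = `[0, 1/2]%classic); last first.
  apply/seteqP; split => x /=; rewrite !in_itv /=.
    by move=> [-> /andP[->]].
  by move=> /andP[x0 x1]; split; lra.
rewrite (eq_integral (cst 1%E)); last first.
  move=> x; rewrite inE /= in_itv /= => /andP[x0 x1].
  by rewrite /uniform_pdf ifT ?subr0 ?invr1//; lra.
rewrite integral_cst//= lebesgue_measure_itv/= lte_fin ifT; last by lra.
by rewrite -EFinB -EFinM; congr EFin; lra.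
Qed.

(** For every m, the first m of these independent draws are all at most 1/2 with probability
    (1/2)^m. The values 0 and 1 of [e] select the even and the odd draws. *)
Lemma small_draws_negligible e :
  P.-negligible (\bigcap_j (u (2 * j + e)%N @^-1` `]-oo, 1/2])).
Proof.
have mN : measurable (\bigcap_j (u (2 * j + e)%N @^-1` `]-oo, 1/2])).
  by apply: bigcapT_measurable => j; exact: measurable_funPTI.
exists (\bigcap_j (u (2 * j + e)%N @^-1` `]-oo, 1/2])); split => //.
set N := (\bigcap_j _) in mN *.
have Pk m : (P N <= ((1/2) ^+ m)%:E)%E.
  pose s := [seq (2 * j + e)%N | j <- iota 0 m].
  have us : uniq s by rewrite map_inj_uniq ?iota_uniq// => a b; lia.
  have E := @indep_u s (fun=> `]-oo, (1/2 : R)%R]%classic) us (fun=> measurable_itv _).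
  apply: (@le_trans _ _ (P (\bigcap_(i in [set` s]) u i @^-1` `]-oo, (1/2 : R)%R]))).
    apply: le_measure; rewrite ?inE//.
    - apply: (@cylinders_measurable _ _ _ P _ u setT).
      by exists s, (fun=> `]-oo, (1/2 : R)]%classic); split.
    - by move=> w H i /= /mapP[j _ ->]; exact: H.
  rewrite E (eq_bigr (fun=> (1/2 : R)%:E)); last first.
    move=> i _; have := unif_u i (measurable_itv `]-oo, (1/2 : R)]).
    by rewrite /distribution /pushforward /= => ->; exact: uniform_prob_half.
  have -> : m = size s by rewrite size_map size_iota.
  rewrite le_eqVlt; apply/orP; left; apply/eqP.
  elim: s {us E} => [|x s IH]; first by rewrite big_nil.
  by rewrite big_cons /= exprS EFinM IH.
have fN : P N \is a fin_num by exact: fin_num_measure.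
apply/eqP; rewrite eq_le measure_ge0 andbT -(fineK fN) lee_fin.
have c : (fun m => (1/2 : R) ^+ m) @ \oo --> (0 : R).
  by apply: cvg_expr; rewrite ger0_norm; lra.
have <- := cvg_lim (@Rhausdorff R) c.
apply: limr_ge; first by apply/cvg_ex; exists 0.
by near=> m; rewrite -lee_fin (fineK fN).
Unshelve. all: by end_near. Qed.

(* A turn with nonnegative draws whose total stays at most 1 cannot contain both
   an even-indexed and an odd-indexed draw above 1/2. *)
Lemma total_gt1 : \forall w \ae P, exists k, 1 < total (draws w) k.
Proof.
have H0 : \forall w \ae P,
    ~ (\bigcap_j (u (2 * j + 0)%N @^-1` `]-oo, 1/2])) w.
  by apply: negligibleS (small_draws_negligible 0) => w /= /contrapT.
have H1 : \forall w \ae P,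
    ~ (\bigcap_j (u (2 * j + 1)%N @^-1` `]-oo, 1/2])) w.
  by apply: negligibleS (small_draws_negligible 1) => w /= /contrapT.
apply: filterS3 H0 H1 draws_range => w H0 H1 H.
have big e : ~ (\bigcap_j (u (2 * j + e)%N @^-1` `]-oo, 1/2])) w ->
    exists j, 1/2 < draws w (2 * j + e)%N.
  move=> K; apply: contrapT => L; apply: K => j _ /=; rewrite in_itv /= leNgt.
  by apply/negP => K; apply: L; exists j.
have [a ha] := big _ H0; have [b hb] := big _ H1.
exists (2 * a + 2 * b + 2)%N.
have ak : (2 * a + 0 < 2 * a + 2 * b + 2)%N by lia.
have bk : (2 * b + 1 < 2 * a + 2 * b + 2)%N by lia.
rewrite /total (bigD1 (Ordinal ak))//= (bigD1 (Ordinal bk))/=; last first.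
  by apply/eqP => -[]; lia.
suff : 0 <= \sum_(i < 2 * a + 2 * b + 2 | (i != Ordinal ak) && (i != Ordinal bk)) draws w i.
  by move=> ?; lra.
by apply: sumr_ge0 => i _; case/andP: (H i).
Qed.

End Process.

(** * Optimal stopping in one turn *)

Section ValueProcess.
Context {R : realType} {d : measure_display} {Omega : measurableType d}.
Variable P : probability Omega R.
Variable u : nat -> {RV P >-> R}.
Hypothesis unif_u : forall k B, measurable B ->
  distribution P (u k) B = uniform_prob (@ltr01 R) B.
Hypothesis indep_u : mutually_independent u.
Variables (pi : policy R) (g F : R -> R).
Hypothesis mpi : measurable_policy pi.
Hypotheses (mg : measurable_fun setT g) (g01 : forall x, 0 <= g x <= 1) (g0 : g 0 = 0).
Hypotheses (mF : measurable_fun setT F) (F01 : forall x, 0 <= F x <= 1).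
Hypothesis F_bust : forall x, 1 < x -> F x = 0.

Local Notation D w := (draws u w).

(* [F] at the current total if the turn is still on after [k] draws, and the
   payoff already banked otherwise. *)
Definition stage_value k w : R :=
  if alive pi (D w) k then F (total (D w) k) else banked g pi (D w) k.

(* [stage_value k.+1] with the draw that may follow stage [k] integrated out. *)
Definition decided_value k w : R :=
  if alive pi (D w) k then
    if turn_over pi (D w) k then bust g (total (D w) k)
    else spin F (total (D w) k)
  else banked g pi (D w) k.

Let mu k : measurable_fun setT (u k). Proof. exact: measurable_funPT. Qed.
Let mpiD k := measurable_policy_mkseq mu k mpi.

Lemma integral_prob_cst (r : R) : (\int[P]_w r%:E = r%:E)%E.
Proof.
by rewrite integral_cst//= probability_setT mule1.
Qed.

Lemma bust_range x : 0 <= bust g x <= 1.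
Proof. by rewrite /bust; case: ifP => // _; rewrite lexx ler01. Qed.

Lemma spin_range x : 0 <= spin F x <= 1.
Proof.
have mFx : measurable_fun setT (fun t => F (x + t)).
  by apply: measurableT_comp => //; exact: measurable_funD.
rewrite -!lee_fin -(spinE x (unif_u 0) mF F01); apply/andP; split.
  by apply: integral_ge0 => w _; rewrite lee_fin; case/andP: (F01 (x + u 0 w)).
apply: (@le_trans _ _ (\int[P]_w (1 : R)%:E)%E); last first.
  by rewrite integral_prob_cst.
apply: ge0_le_integral => //.
- by move=> w _; rewrite lee_fin; case/andP: (F01 (x + u 0 w)).
- apply/measurable_EFinP; apply: measurableT_comp => //; exact: measurable_funD.
- by move=> w _; rewrite lee_fin; case/andP: (F01 (x + u 0 w)).
Qed.

Lemma stage_value_range k w : 0 <= stage_value k w <= 1.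
Proof. by rewrite /stage_value; case: ifP => // _; exact: banked_range. Qed.

Lemma decided_value_range k w : 0 <= decided_value k w <= 1.
Proof.
rewrite /decided_value; case: ifP => [_|_]; last exact: banked_range.
by case: ifP => _; [exact: bust_range|exact: spin_range].
Qed.

Lemma measurable_stage_value k : measurable_fun setT (stage_value k).
Proof.
apply: measurable_fun_ifT; first exact: measurable_alive.
  by apply: measurableT_comp => //; exact: measurable_total.
exact: measurable_banked.
Qed.

Lemma measurable_decided_value k : measurable_fun setT (decided_value k).
Proof.
apply: measurable_fun_ifT; first exact: measurable_alive; last exact: measurable_banked.
apply: measurable_fun_ifT; first exact: measurable_turn_over.
  by apply: measurableT_comp; [exact: measurable_bust|exact: measurable_total].
by apply: measurableT_comp; [exact: measurable_spin (unif_u 0) mF F01|exact: measurable_total].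
Qed.

Lemma measurable_payoff : measurable_fun setT (fun w => g (turn_score pi (D w))).
Proof. by apply: measurableT_comp => //; exact: (measurable_turn_score mu mpiD). Qed.

(** The state after k draws is a function of the past, and draw number k is independent of it. If
    the player continues, averaging this draw turns F into [spin F]; otherwise the draw has no
    effect. *)
Lemma stage_value_step k : (\int[P]_w (stage_value k.+1 w)%:E = \int[P]_w (decided_value k w)%:E)%E.
Proof.
pose v (z : sigma_of u (past k) * R) := past_draws u k ^~ z.1.
pose f (z : sigma_of u (past k) * R) : R :=
  if alive pi (v z) k then
    if turn_over pi (v z) k then bust g (total (v z) k)
    else F (total (v z) k + z.2)
  else banked g pi (v z) k.
have vD w t j : (j < k)%N -> v (w, t) j = D w j by exact: past_drawsE.
have mv j : measurable_fun setT (fun z => v z j).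
  apply: (measurableT_comp (f := past_draws u k j : sigma_of u (past k) -> R)) => //.
  exact: measurable_past_draws.
have mpiv j := measurable_policy_mkseq mv j mpi.
have mf : measurable_fun setT (fun z => (f z)%:E).
  apply/measurable_EFinP.
  apply: measurable_fun_ifT; first exact: (measurable_alive mv mpiv).
    apply: measurable_fun_ifT; first exact: (measurable_turn_over mv mpiv).
      by apply: measurableT_comp; [exact: measurable_bust|exact: (measurable_total mv)].
    by apply: measurableT_comp => //; apply: measurable_funD => //; exact: (measurable_total mv).
  exact: (measurable_banked mv mpiv).
have f0 z : (0 <= (f z)%:E)%E.
  rewrite lee_fin /f; case: ifP => _; first case: ifP => _.
  - by case/andP: (bust_range (total (v z) k)).
  - by case/andP: (F01 (total (v z) k + z.2)).
  - by case/andP: (banked_range pi (v z) k g01).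
have fE w t : f (w, t) =
  if alive pi (D w) k then
    if turn_over pi (D w) k then bust g (total (D w) k)
    else F (total (D w) k + t)
  else banked g pi (D w) k.
  by rewrite /f (alive_agree pi (vD w t))// (turn_over_agree pi (vD w t))//
    (total_agree (vD w t))// (banked_agree pi (vD w t)).
transitivity (\int[P]_w (f (w, u k w))%:E)%E.
  apply: eq_integral => w _; rewrite fE /stage_value /= totalS.
  by case: (alive _ _ _) => //=; case: (turn_over _ _ _).
rewrite (indep_next indep_u mf f0); apply: eq_integral => w _.
under eq_integral do rewrite fE.
rewrite /decided_value; case: ifP => _; first case: ifP => _.
- by rewrite integral_prob_cst.
- exact: (spinE _ (unif_u k) mF F01).
- by rewrite integral_prob_cst.
Qed.

Lemma stage_value0 : (\int[P]_w (stage_value 0 w)%:E = (F 0)%:E)%E.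
Proof.
under eq_integral do rewrite /stage_value /= total_draws0.
by rewrite integral_prob_cst.
Qed.

(** Almost every turn ends, at the latest by a bust, so the stage values are eventually equal to the
    payoff; being bounded by 1, they converge in expectation. *)
Lemma stage_value_cvg :
  (\int[P]_w (stage_value k w)%:E)%E @[k --> \oo] -->
  (\int[P]_w (g (turn_score pi (D w)))%:E)%E.
Proof.
have mval k : measurable_fun setT (fun w => (stage_value k w)%:E).
  by apply/measurable_EFinP; exact: measurable_stage_value.
have mpay : measurable_fun setT (fun w => (g (turn_score pi (D w)))%:E).
  by apply/measurable_EFinP; exact: measurable_payoff.
have cvg_value : {ae P, forall w, setT w ->
    (stage_value k w)%:E @[k --> \oo] --> (g (turn_score pi (D w)))%:E}.
  apply: filterS (total_gt1 unif_u indep_u) => w [k k1] _.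
  have ok : turn_over pi (D w) k.
    rewrite /turn_over k1 andbT; case: k k1 => //.
    by rewrite total_draws0 ltr10.
  apply: cvg_near_cst; exists k.+1 => // m /= km.
  by rewrite /stage_value (alive_over ok km) (banked_score g0 ok km).
have int1 : P.-integrable setT (cst 1%E).
  apply/integrableP; split => //.
  under eq_integral do rewrite /= normr1.
  by rewrite integral_prob_cst ltry.
have dom : {ae P, forall w k, setT w -> (`|(stage_value k w)%:E| <= cst 1 w)%E}.
  apply: aeW => w k _; have /andP[v0 v1] := stage_value_range k w.
  by rewrite lee_fin ger0_norm.
by have [] := dominated_convergence measurableT mval mpay cvg_value int1 dom.
Qed.

Lemma decided_value_eq k w : 0 <= total (D w) k ->
  (alive pi (D w) k -> turn_over pi (D w) k -> total (D w) k <= 1 ->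
     g (total (D w) k) = F (total (D w) k)) ->
  (alive pi (D w) k -> ~~ turn_over pi (D w) k -> total (D w) k <= 1 ->
     spin F (total (D w) k) = F (total (D w) k)) ->
  decided_value k w = stage_value k w.
Proof.
move=> t0 gF TF; rewrite /decided_value /stage_value; case: ifP => // ak.
case: ifPn => ok.
  rewrite /bust; case: ifPn => [t1|]; first by rewrite gF.
  by rewrite -ltNge => /F_bust ->.
apply: TF => //; move: ok; rewrite /turn_over; case: (k) => [|k'] /=.
  by rewrite total_draws0.
by rewrite negb_or -leNgt => /andP[].
Qed.

Lemma decided_value_le k w : (forall x, x <= 1 -> g x <= F x) ->
  (forall x, x <= 1 -> spin F x <= F x) -> decided_value k w <= stage_value k w.
Proof.
move=> gF TF; rewrite /decided_value /stage_value; case: ifP => // ak.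
case: ifPn => ok.
  rewrite /bust; case: ifPn => [t1|]; first exact: gF.
  by rewrite -ltNge => /F_bust ->.
apply: TF => //; move: ok; rewrite /turn_over; case: (k) => [|k'] /=.
  by rewrite total_draws0.
by rewrite negb_or -leNgt => /andP[].
Qed.

(** If F equals the payoff where the policy stops and its own average where it continues, the stage
    values have constant expectation F(0), as for a martingale, and the limit is the expected
    payoff. *)
Lemma expected_payoff_eq :
    (forall k, \forall w \ae P,
      (alive pi (D w) k -> turn_over pi (D w) k -> total (D w) k <= 1 ->
        g (total (D w) k) = F (total (D w) k)) /\
      (alive pi (D w) k -> ~~ turn_over pi (D w) k -> total (D w) k <= 1 ->
        spin F (total (D w) k) = F (total (D w) k))) ->
  (\int[P]_w (g (turn_score pi (D w)))%:E = (F 0)%:E)%E.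
Proof.
move=> H; have E k : (\int[P]_w (stage_value k w)%:E = (F 0)%:E)%E.
  elim: k => [|k IH]; first exact: stage_value0.
  rewrite stage_value_step -IH; apply: ge0_ae_eq_integral => //.
  - by apply/measurable_EFinP; exact: measurable_decided_value.
  - by apply/measurable_EFinP; exact: measurable_stage_value.
  - by move=> w _; rewrite lee_fin; case/andP: (decided_value_range k w).
  - by move=> w _; rewrite lee_fin; case/andP: (stage_value_range k w).
  - apply: filterS2 (H k) (total_ge0 unif_u) => w [gF TF] t0 _.
    by rewrite (decided_value_eq (t0 k)).
have := stage_value_cvg; under eq_cvg do rewrite E.
by move=> /cvg_lim <-//; rewrite lim_cst.
Qed.

(** F dominates both the payoff of stopping and its own average after one spin, so the stage values
    behave like a supermartingale. *)
Lemma stage_value_nonincreasing k : (forall x, x <= 1 -> g x <= F x) ->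
  (forall x, x <= 1 -> spin F x <= F x) ->
  (\int[P]_w (stage_value k.+1 w)%:E <= \int[P]_w (stage_value k w)%:E)%E.
Proof.
move=> gF TF; rewrite stage_value_step; apply: ge0_le_integral => //.
- by move=> w _; rewrite lee_fin; case/andP: (decided_value_range k w).
- by apply/measurable_EFinP; exact: measurable_decided_value.
- by apply/measurable_EFinP; exact: measurable_stage_value.
- by move=> w _; rewrite lee_fin decided_value_le.
Qed.

Lemma expected_payoff_le_stage_value k : (forall x, x <= 1 -> g x <= F x) ->
  (forall x, x <= 1 -> spin F x <= F x) ->
  (\int[P]_w (g (turn_score pi (D w)))%:E <= \int[P]_w (stage_value k w)%:E)%E.
Proof.
move=> gF TF; have H m : (\int[P]_w (stage_value (m + k) w)%:E <= \int[P]_w (stage_value k w)%:E)%E.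
  elim: m => // m IH; apply: le_trans IH; exact: stage_value_nonincreasing.
have := stage_value_cvg => /cvg_lim <-//.
apply: lime_le; first by apply/cvg_ex; eexists; exact: stage_value_cvg.
by exists k => // m /= km; rewrite -(subnK km).
Qed.

Lemma expected_payoff_le : (forall x, x <= 1 -> g x <= F x) ->
  (forall x, x <= 1 -> spin F x <= F x) ->
  (\int[P]_w (g (turn_score pi (D w)))%:E <= (F 0)%:E)%E.
Proof. by move=> gF TF; rewrite -stage_value0; exact: expected_payoff_le_stage_value. Qed.

(** Attaining F(0) forces every stage value to have expectation F(0). The nonnegative difference
    between [stage_value] and [decided_value] then has integral 0 and vanishes almost surely. *)
Lemma expected_payoff_tight : (forall x, x <= 1 -> g x <= F x) ->
  (forall x, x <= 1 -> spin F x <= F x) ->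
  ((F 0)%:E <= \int[P]_w (g (turn_score pi (D w)))%:E)%E ->
  forall k, \forall w \ae P, decided_value k w = stage_value k w.
Proof.
move=> gF TF tight k.
have le0 j : (\int[P]_w (stage_value j w)%:E <= (F 0)%:E)%E.
  elim: j => [|j IH]; first by rewrite stage_value0.
  exact: le_trans (stage_value_nonincreasing _ gF TF) IH.
have E j : (\int[P]_w (stage_value j w)%:E = (F 0)%:E)%E.
  apply/eqP; rewrite eq_le le0/=.
  exact: le_trans tight (expected_payoff_le_stage_value _ gF TF).
have intb (f : Omega -> R) : measurable_fun setT f -> (forall w, 0 <= f w <= 1) ->
    P.-integrable setT (EFin \o f).
  move=> mf f01; apply: (@le_integrable _ _ _ _ _ _ _ (cst (1 : R)%:E)) => //.
  - exact/measurable_EFinP.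
  - by move=> w _ /=; case/andP: (f01 w) => f0 f1; rewrite lee_fin ger0_norm// normr1.
  - apply/integrableP; split => //.
    under eq_integral do rewrite /= normr1.
    by rewrite integral_prob_cst ltry.
have md := measurable_decided_value k; have mv := measurable_stage_value k.
have : (\int[P]_w `|(stage_value k w)%:E - (decided_value k w)%:E| = 0)%E.
  transitivity (\int[P]_w ((stage_value k w)%:E - (decided_value k w)%:E))%E.
    apply: eq_integral => w _; rewrite gee0_abs//.
    by rewrite -EFinB lee_fin subr_ge0 decided_value_le.
  rewrite integralB//; [|exact: intb (stage_value_range k)|exact: intb (decided_value_range k)].
  by rewrite -stage_value_step !E subee.
move=> /(ae_eq_integral_abs _ measurableT)[].
  by apply: emeasurable_funB; apply/measurable_EFinP.
move=> N HN; exists N; case: HN => mN N0 HN; split => // w /= ne; apply: HN => /= K.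
by apply: ne; have := K I; rewrite -EFinB => -[]/eqP; rewrite subr_eq0 => /eqP.
Qed.

End ValueProcess.

(** * The optimal threshold in one turn *)

Section OneTurn.
Context {R : realType} {d : measure_display} {Omega : measurableType d}.
Variable P : probability Omega R.
Variable u : nat -> {RV P >-> R}.
Hypothesis unif_u : forall k B, measurable B ->
  distribution P (u k) B = uniform_prob (@ltr01 R) B.
Hypothesis indep_u : mutually_independent u.

Variables (g : R -> R) (m : nat) (M : R).
Hypotheses (mg : measurable_fun setT g) (g01 : forall x, 0 <= g x <= 1).
Hypothesis M01 : 0 <= M <= 1.
Hypothesis g_lose : forall x, 0 <= x -> x <= M -> g x = 0.
Hypothesis g_high : forall x, M < x -> theta m.+1 <= x -> x < 1 -> g x = bust_prob x ^+ m.
Hypothesis g_low : forall x, M < x -> x < theta m.+1 -> g x <= bust_prob (theta m.+1) ^+ m.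

Local Notation kappa := (Num.max (theta m.+1) M).
Local Notation F := (cont_value m kappa).
Local Notation D w := (draws u w).

Lemma kappa_range : 0 <= kappa <= 1.
Proof.
by have /andP[M0 M1] := M01; rewrite le_max theta_ge0/= ge_max theta_le1 M1.
Qed.

Lemma stop_at0 : g 0 = 0.
Proof. by have /andP[M0 M1] := M01; exact: g_lose. Qed.

Lemma bust_integral_kappa_gt0 : kappa < 1 -> 0 < bust_integral m kappa.
Proof.
move=> k1; rewrite -(bust_integral1 m); apply: bust_integral_lt => //; by case/andP: kappa_range.
Qed.

(** Up to M stopping pays 0. If M < x <= kappa, then kappa is theta, and the theta equation rewrites
    the bound Q(theta)^m as the integral. *)
Lemma payoff_le_bust_integral x : 0 <= x -> x <= kappa -> g x <= bust_integral m kappa.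
Proof.
have /andP[M0 M1] := M01; have /andP[k0 k1] := kappa_range.
move=> x0 xk; have [xM|Mx] := leP x M.
  by rewrite g_lose// bust_integral_ge0.
have e : kappa = theta m.+1.
  by apply/max_idPl; move: xk; rewrite le_max => /orP[|]; lra.
rewrite e in xk *; have [_ <-] := theta_spec (R := R) m.+1.
move: xk; rewrite le_eqVlt => /predU1P[xe|xt]; last exact: g_low.
by rewrite -xe g_high// xe ?theta_lt1.
Qed.

Lemma payoff_le_cont_value x : x <= 1 -> g x <= F x.
Proof.
have /andP[M0 M1] := M01; have /andP[k0 k1] := kappa_range.
move=> x1; have [x0|x0] := ltP x 0.
  by rewrite /cont_value x0; case/andP: (g01 x).
have [xk|kx] := leP x kappa.
  rewrite cont_value_le//; apply: le_trans (payoff_le_bust_integral x0 xk) _.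
  rewrite ler_peMl ?bust_integral_ge0//; have := expR_ge1Dx (kappa - x); lra.
rewrite cont_value_gt ?kappa_range//.
(* The formula for [g] is available only below 1; at 1 it suffices that [g] is at most 1 and Q(1) =
   1. *)
move: x1; rewrite le_eqVlt => /predU1P[->|x1].
  by rewrite bust_prob1 expr1n; case/andP: (g01 1).
by move: kx; rewrite gt_max => /andP[kx Mx]; rewrite g_high// ltW.
Qed.

Lemma spin_le_cont_value x : x <= 1 -> spin F x <= F x.
Proof.
move=> x1; have [x0|x0] := ltP x 0.
  rewrite {2}/cont_value x0.
  have := spin_range unif_u (measurable_cont_value m kappa) (cont_value_range m kappa_range) x.
  by case/andP.
have [xk|kx] := leP x kappa.
  by rewrite spin_cont_value_le// kappa_range.
rewrite spin_cont_value_gt ?cont_value_gt ?kappa_range//.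
by apply: (bust_integral_le_bust_prob (r := m.+1)) => //; move: kx; rewrite gt_max => /andP[/ltW].
Qed.

Lemma expected_payoff_le_cont_value pi : measurable_policy pi ->
  (\int[P]_w (g (turn_score pi (D w)))%:E <= (F 0)%:E)%E.
Proof.
move=> mpi; apply: (expected_payoff_le unif_u indep_u mpi) => //.
- exact: stop_at0.
- exact: measurable_cont_value.
- exact: (cont_value_range m kappa_range).
- by move=> x; apply: cont_value_bust; exact: kappa_range.
- exact: payoff_le_cont_value.
- exact: spin_le_cont_value.
Qed.

Lemma turn_overP (pi : policy R) w k : turn_over pi (D w) k -> total (D w) k <= 1 ->
  (0 < k)%N /\ pi (mkseq (D w) k).
Proof. by rewrite /turn_over leNgt => /andP[-> /orP[->|]]. Qed.

Lemma turn_not_overP (pi : policy R) w k : ~~ turn_over pi (D w) k -> (0 < k)%N ->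
  ~~ pi (mkseq (D w) k).
Proof. by rewrite /turn_over negb_and negb_or => /orP[/negP//|/andP[]]. Qed.

Lemma sum_mkseq (v : nat -> R) k : \sum_(x <- mkseq v k) x = total v k.
Proof. by rewrite big_map /total -(big_mkord xpredT v) /index_iota subn0. Qed.

Lemma total_neq_ae k (c : R) : \forall w \ae P, (0 < k)%N -> total (D w) k != c.
Proof.
case: k => [|k]; first exact: aeW.
by apply: filterS (total_neq unif_u indep_u k c).
Qed.

Lemma threshold_expected_payoff pi : measurable_policy pi -> follows_threshold kappa pi ->
  (\int[P]_w (g (turn_score pi (D w)))%:E = (F 0)%:E)%E.
Proof.
have /andP[k0 k1] := kappa_range.
move=> mpi thr; apply: (expected_payoff_eq unif_u indep_u mpi) => //.
- exact: stop_at0.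
- exact: measurable_cont_value.
- exact: (cont_value_range m kappa_range).
- by move=> x; apply: cont_value_bust; exact: kappa_range.
move=> k; apply: filterS3 (total_neq_ae k kappa) (total_neq_ae k 1) (total_ge0 unif_u).
move=> w nk n1 t0; have [lo hi] := thr (mkseq (D w) k); rewrite sum_mkseq in lo hi.
split => _ ok t1.
- have [kp pik] := turn_overP ok t1.
  have kt : kappa < total (D w) k.
    rewrite lt_neqAle eq_sym nk//= leNgt; apply/negP => /lo; by rewrite pik.
  rewrite cont_value_gt ?kappa_range//; move: kt; rewrite gt_max => /andP[kt Mt].
  by rewrite g_high// ?ltW// lt_neqAle n1.
- apply: spin_cont_value_le => //; first exact: kappa_range.
  case: (posnP k) => [->|kp]; first by rewrite total_draws0.
  rewrite leNgt; apply/negP => /hi; apply/negP; exact: turn_not_overP.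
Qed.

(** By tightness, an optimal policy loses nothing at any stage. Stopping below kappa would lose,
    since e^(kappa - x) > 1 multiplies a positive integral; continuing above kappa would lose, since
    the theta gap is positive there. *)
Lemma optimal_agrees_threshold pi : kappa < 1 -> measurable_policy pi ->
  ((F 0)%:E <= \int[P]_w (g (turn_score pi (D w)))%:E)%E ->
  forall k, \forall w \ae P,
    (alive pi (D w) k -> turn_over pi (D w) k -> total (D w) k <= 1 ->
      kappa < total (D w) k) /\
    (alive pi (D w) k -> ~~ turn_over pi (D w) k -> total (D w) k <= 1 ->
      total (D w) k <= kappa).
Proof.
have /andP[k0 k1] := kappa_range.
move=> klt1 mpi opt k.
have := expected_payoff_tight unif_u indep_u mpi mg g01 stop_at0 (measurable_cont_value m kappa)
  (cont_value_range m kappa_range) (fun x => cont_value_bust m kappa_range (x := x))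
  payoff_le_cont_value spin_le_cont_value opt k => tight.
apply: filterS3 (total_neq_ae k kappa) (total_ge0 unif_u) tight.
move=> w nk t0; rewrite /decided_value /stage_value => + ; split => ak ok t1; move: H; rewrite ak.
- rewrite ok /bust t1 => gF; have [kp pik] := turn_overP ok t1.
  rewrite ltNge; apply/negP => tk.
  have {}tk : total (D w) k < kappa by rewrite lt_neqAle nk.
  have := payoff_le_bust_integral (t0 k) (ltW tk); rewrite gF cont_value_le// ?(ltW tk)//.
  apply/negP; rewrite -ltNge ltr_pMl ?bust_integral_kappa_gt0//.
  have := expR_ge1Dx (kappa - total (D w) k); lra.
- rewrite (negbTE ok) leNgt => sF; apply/negP => kt; move: sF.
  rewrite spin_cont_value_gt ?cont_value_gt ?kappa_range// => e.
  have : theta m.+1 < total (D w) k by move: kt; rewrite gt_max => /andP[].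
  by move=> /bust_integral_lt_bust_prob/(_ t1) /=; rewrite e ltxx.
Qed.

Lemma bust_integral0 (x : R) : 0 <= x -> x <= 1 -> bust_integral 0 x = 1 - x.
Proof.
move=> x0 x1; transitivity (\int[lebesgue_measure]_(t in `[x, 1]) (1 : R)).
  by apply: eq_Rintegral => t _; rewrite expr0.
rewrite Rintegral_cst//= lebesgue_measure_itv /= lte_fin mul1r.
by case: ltP => //= ?; lra.
Qed.

(** Almost surely the policy stops exactly above kappa >= M, so its score falls below M only by a
    bust. The bust probability comes from the martingale identity applied to a second payoff. *)
Lemma optimal_score_lt_prob pi : 0 < M -> kappa < 1 -> measurable_policy pi ->
  ((F 0)%:E <= \int[P]_w (g (turn_score pi (D w)))%:E)%E ->
  P [set w | turn_score pi (D w) < M] = (bust_prob kappa)%:E.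
Proof.
have /andP[M0 M1] := M01; have /andP[k0 k1] := kappa_range.
move=> Mpos klt1 mpi opt; have agree := optimal_agrees_threshold klt1 mpi opt.
(* This payoff turns the expectation into the probability of a score of at least M. It equals Q^0
   above kappa, so the matching value function is [cont_value] with exponent 0, whose value at 0 is
   (1 - kappa) e^kappa = 1 - Q(kappa). *)
pose g' (x : R) : R := \1_`[M, 1] x.
have mg' : measurable_fun setT g' by exact: measurable_indic.
have g'01 x : 0 <= g' x <= 1.
  by rewrite /g' indicE; case: (_ \in _); rewrite ?lexx ler01.
(* Positivity of M separates the score 0 of a bust from the scores that are paid. *)
have g'0 : g' 0 = 0.
  by rewrite /g' indicE memNset//= in_itv /=; move=> /andP[]; rewrite leNgt Mpos.
have mscore : measurable_fun setT (fun w => turn_score pi (D w)).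
  have mu k : measurable_fun setT (u k) by exact: measurable_funPT.
  exact: (measurable_turn_score mu (fun k => measurable_policy_mkseq mu k mpi)).
have E : (\int[P]_w (g' (turn_score pi (D w)))%:E = (cont_value 0 kappa 0)%:E)%E.
  apply: (expected_payoff_eq unif_u indep_u mpi) => //.
  - exact: measurable_cont_value.
  - exact: (cont_value_range 0 kappa_range).
  - by move=> x; apply: cont_value_bust; exact: kappa_range.
  move=> k; apply: filterS2 (agree k) (total_ge0 unif_u) => w [hi lo] t0.
  split => ak ok t1.
  - have kt := hi ak ok t1; rewrite cont_value_gt ?kappa_range// expr0.
    rewrite /g' indicE mem_set//= in_itv /= t1 andbT.
    by move: kt; rewrite gt_max => /andP[_ /ltW].
  - by apply: spin_cont_value_le => //; [exact: kappa_range|exact: lo].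
have mlt : measurable [set w | turn_score pi (D w) < M].
  rewrite (_ : [set _ | _] = (fun w => turn_score pi (D w)) @^-1` `]-oo, M[).
    by rewrite -[X in measurable X]setTI; exact: mscore.
  by apply/seteqP; split => w /=; rewrite in_itv.
have : P (~` [set w | turn_score pi (D w) < M]) = (cont_value 0 kappa 0)%:E.
  have mge := measurableC mlt; rewrite -E.
  transitivity (\int[P]_w (\1_(~` [set w | turn_score pi (D w) < M]) w)%:E)%E.
    by rewrite integral_indic// setIT.
  apply: eq_integral => w _; rewrite /g' !indicE; congr (_%:R%:E); congr nat_of_bool.
  apply/idP/idP; rewrite !inE /= in_itv /= turn_score_le1 andbT.
    by move=> /negP; rewrite -leNgt.
  by rewrite leNgt => /negP.
rewrite probability_setC// cont_value_le// subr0 bust_integral0//.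
have /fineK <- : P [set w | turn_score pi (D w) < M] \is a fin_num by exact: fin_num_measure.
rewrite -EFinB => -[e]; congr EFin; rewrite bust_probE; lra.
Qed.

End OneTurn.

(** * The game *)

Section Histories.
Context {R : realType}.
Implicit Types (h : seq R) (sigma : profile R).

Lemma max_score_lt h x : (max_score h < x) = (0 < x) && all (fun y => y < x) h.
Proof.
rewrite /max_score; elim: h => [|y h IH]; first by rewrite big_nil andbT.
by rewrite big_cons /= gt_max IH andbCA.
Qed.

Lemma max_score_range h : valid_history h -> 0 <= max_score h <= 1.
Proof.
rewrite /max_score /valid_history; elim: h => [|y h IH] v.
  by rewrite big_nil lexx ler01.
have /andP[y0 y1] := v y (mem_head _ _).
have /IH/andP[h0 h1] : forall x, x \in h -> 0 <= x <= 1.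
  by move=> x xh; apply: v; rewrite inE xh orbT.
by rewrite big_cons le_max y0 ge_max y1 h1.
Qed.

(** The base value 0 of the maximum matches the positivity required of a winner. *)
Lemma wins_rcons h x : wins (size h) (rcons h x) <-> max_score h < x.
Proof.
rewrite max_score_lt /wins nth_rcons ltnn eqxx size_rcons; split.
  move=> [-> H] /=; apply/allP => y /(nthP 0)[j jh <-].
  have /negP jn : j != size h by rewrite neq_ltn jh.
  by have := H j (ltnW jh) (fun e => jn (introT eqP e)); rewrite nth_rcons jh.
move=> /andP[-> /allP H]; split => // j; rewrite ltnS leq_eqVlt => /predU1P[->//|jh] _.
by rewrite nth_rcons jh; apply: H; exact: mem_nth.
Qed.

Lemma wins_max_score p h : (p < size h)%N -> wins p h -> valid_history h ->
  max_score h = h`_p.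
Proof.
move=> ph [p0 H] v; apply/eqP; rewrite eq_le; apply/andP; split.
  rewrite leNgt; apply/negP => lt.
  suff : max_score h < max_score h by rewrite ltxx.
  rewrite {1}max_score_lt (lt_trans p0)//=; apply/allP => y /(nthP 0)[j jh <-].
  by have [->//|/eqP/(H _ jh)/lt_trans] := eqVneq j p; exact.
rewrite leNgt max_score_lt; apply/negP => /andP[_ /allP/(_ _ (mem_nth 0 ph))].
by rewrite ltxx.
Qed.

Lemma wins_rcons_lt p h x : (p < size h)%N -> wins p h ->
  wins p (rcons h x) <-> x < h`_p.
Proof.
move=> ph [p0 H]; rewrite /wins nth_rcons ph size_rcons; split.
  move=> [_ /(_ (size h) (ltnSn _))]; rewrite nth_rcons ltnn eqxx; apply.
  by move=> e; rewrite e ltnn in ph.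
move=> xp; split => // j; rewrite ltnS leq_eqVlt nth_rcons => /predU1P[->|jh] jp.
  by rewrite ltnn eqxx.
by rewrite jh; exact: H.
Qed.

Lemma size_play sigma u m h : size (play sigma u m h) = (size h + m)%N.
Proof. by elim: m h => [|m IH] h /=; rewrite ?addn0// IH size_rcons addnS. Qed.

Lemma nth_play sigma u m h j : (j < size h)%N -> (play sigma u m h)`_j = h`_j.
Proof.
elim: m h => // m IH h jh /=; rewrite IH ?size_rcons ?ltnS 1?ltnW//.
by rewrite nth_rcons jh.
Qed.

Lemma wins_play p sigma u m h : (p < size h)%N -> wins p (play sigma u m h) -> wins p h.
Proof.
move=> ph [p0 H]; rewrite nth_play// in p0 H; split => // j jh jp.
by have := H j; rewrite size_play nth_play//; apply => //; rewrite ltn_addr.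
Qed.

Lemma valid_rcons h x : valid_history h -> 0 <= x <= 1 -> valid_history (rcons h x).
Proof. by move=> v x01 y; rewrite mem_rcons inE => /predU1P[->//|]; exact: v. Qed.

End Histories.

(** * Measurability of the outcome of the game *)

Section MeasurablePlay.
Context {R : realType} {d : measure_display} {T : measurableType d}.
Variables (sigma : profile R) (v : nat -> nat -> T -> R).
Hypothesis msigma : measurable_profile sigma.

Local Notation V x := (fun i k => v i k x).

(** Measurability is asked only of the draws of players still to play, so that the sigma-algebra of
    the later turns can be used on [T]. *)
Lemma measurable_play r q (hist : T -> seq R) :
    (forall x, size (hist x) = q) ->
    (forall j, measurable_fun setT (fun x => (hist x)`_j)) ->
    (forall i k, (q <= i < q + r)%N -> measurable_fun setT (v i k)) ->
  forall j, measurable_fun setT (fun x => (play sigma (V x) r (hist x))`_j).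
Proof.
elim: r q hist => // r IH q hist sq mh mv j /=.
pose hist' x := rcons (hist x) (turn_score (sigma (hist x)) (fun k => v q k x)).
rewrite (_ : (fun _ => _) = (fun x => (play sigma (V x) r (hist' x))`_j)); last first.
  by apply/funext => x; rewrite /hist' sq.
apply: (IH q.+1).
- by move=> x; rewrite size_rcons sq.
- move=> i; have mvq k : measurable_fun setT (v q k).
    by apply: mv; rewrite leqnn -[X in (X < _)%N]addn0 ltn_add2l.
  have ms := measurable_turn_score (D := fun x => sigma (hist x)) mvq
    (fun k => measurable_profile_mkseq mvq k msigma sq mh).
  rewrite /hist'; under eq_fun do rewrite nth_rcons sq.
  case: (i < q)%N; first exact: mh.
  by case: (i == q); [exact: ms|exact: measurable_cst].
- by move=> i k /andP[qi ir]; apply: mv; rewrite (ltnW qi) -addSnnS.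
Qed.

Lemma measurable_wins_play p r q (hist : T -> seq R) :
    (forall x, size (hist x) = q) ->
    (forall j, measurable_fun setT (fun x => (hist x)`_j)) ->
    (forall i k, (q <= i < q + r)%N -> measurable_fun setT (v i k)) ->
  measurable [set x | wins p (play sigma (V x) r (hist x))].
Proof.
move=> sq mh mv; have mp := measurable_play sq mh mv.
(* A finite boolean conjunction over players replaces the quantifier in [wins]. *)
pose b x := (0 < (play sigma (V x) r (hist x))`_p) &&
  all (fun j => (j == p) || ((play sigma (V x) r (hist x))`_j < (play sigma (V x) r (hist x))`_p))
    (iota 0 (q + r)).
have mb : measurable_fun setT b.
  apply: measurable_and; first exact: measurable_fun_ltr.
  elim: (iota 0 (q + r)) => [|j s IH] /=; first exact: measurable_cst.
  apply: measurable_and => //; apply: measurable_or => //.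
  exact: measurable_fun_ltr.
rewrite (_ : [set _ | _] = b @^-1` [set true]).
  by rewrite -[X in measurable X]setTI; exact: mb.
apply/seteqP; split => x /=; rewrite /b /wins size_play sq.
  move=> [-> H]; apply/allP => j; rewrite mem_iota add0n => /andP[_ jq].
  by case: eqVneq => //= /eqP; exact: H.
move=> /andP[-> /allP H]; split => // j jq jp.
by have := H j; rewrite mem_iota add0n jq => /(_ isT) /orP[/eqP|].
Qed.

End MeasurablePlay.

(** * Failure probability of the later players *)

Section Survival.
Context {R : realType}.

(* The probability that [r] more players, all playing optimally, fail to beat
   the score [s]. *)
Definition survival (r : nat) (s : R) : R :=
  \prod_(j < r) bust_prob (Num.max (theta j.+1) s).

Lemma survival_high r (x : R) : theta r.+1 <= x -> survival r x = bust_prob x ^+ r.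
Proof.
move=> tx; rewrite /survival -[in RHS](card_ord r) -prodr_const.
apply: eq_bigr => j _; congr bust_prob; apply/max_idPr.
by apply: le_trans tx; apply: theta_le => //; rewrite ltnS ltnW.
Qed.

Lemma survival_low r (x : R) : 0 <= x -> x < theta r.+1 ->
  survival r x <= bust_prob (theta r.+1) ^+ r.
Proof.
move=> x0; have t1 := theta_le1 (R := R) r.+1.
have : forall j, (j < r)%N -> theta j.+1 <= theta r.+1 :> R.
  by move=> j jr; apply: theta_le => //; rewrite ltnS ltnW.
move: (theta r.+1) t1 => t t1 tj xt; rewrite /survival -[in leRHS](card_ord r) -prodr_const.
apply: ler_prod => j _.
have mx : Num.max (theta j.+1) x <= t by rewrite ge_max tj// ltW.
have m0 : 0 <= Num.max (theta j.+1) x by rewrite le_max x0 orbT.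
by rewrite (bust_prob_le m0 mx t1) andbT; apply: bust_prob_ge0 => //; exact: le_trans mx t1.
Qed.

Lemma survivalS r (s : R) :
  survival r.+1 s = survival r s * bust_prob (Num.max (theta r.+1) s).
Proof. by rewrite /survival big_ord_recr. Qed.

End Survival.

(** * Conditioning on the score of a turn *)

Section Game.
Context {R : realType} {d : measure_display} {Omega : measurableType d}.
Variables (P : probability Omega R) (n : nat) (U : nat -> nat -> {RV P >-> R}).
Variable sigma : profile R.
Hypothesis iidU : iid_uniform n U.
Hypothesis msigma : measurable_profile sigma.

Local Notation X := (fun ik : 'I_n * nat => U ik.1 ik.2).

Lemma indep_turn m : (m < n)%N -> mutually_independent (U m).
Proof.
move=> mn s B us mB; have [_ iU] := iidU.
pose i := Ordinal mn.
have us' : uniq [seq (i, k) | k <- s] by rewrite map_inj_uniq// => a b [].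
have := iU [seq (i, k) | k <- s] (fun ik => B ik.2) us' (fun ik => mB ik.2).
rewrite big_map /= => <-; congr (P _); apply/seteqP; split => w H.
  by move=> ik /= /mapP[k ks ->]; exact: H.
by move=> k /= ks; apply: (H (i, k)); exact: map_f.
Qed.

Lemma unif_turn m k B : (m < n)%N -> measurable B ->
  distribution P (U m k) B = uniform_prob (@ltr01 R) B.
Proof. by move=> mn; case: iidU => uU _; exact: uU. Qed.

Definition win_after (p : nat) (s : seq R) : \bar R :=
  P [set w | wins p (play sigma (fun i k => U i k w) (n - size s) s)].

Lemma measurable_win_after_set p (s : seq R) :
  measurable [set w | wins p (play sigma (fun i k => U i k w) (n - size s) s)].
Proof.
apply: (measurable_wins_play (v := fun i k w => U i k w) msigma p (q := size s)
  (hist := fun=> s)) => //.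
Qed.

Lemma win_after_range p s : (0 <= win_after p s <= 1)%E.
Proof. by rewrite /win_after measure_ge0 probability_le1//; exact: measurable_win_after_set. Qed.

Lemma win_after_lost p s : (p < size s)%N -> ~ wins p s -> win_after p s = 0%E.
Proof.
move=> ps nw; rewrite /win_after (_ : [set _ | _] = set0) ?measure0//.
by apply/seteqP; split => w //= /(wins_play ps).
Qed.

Definition this_turn (m : nat) : set ('I_n * nat) := [set ik : 'I_n * nat | ik.1 = m :> nat].
Definition later_turns (m : nat) : set ('I_n * nat) := [set ik : 'I_n * nat | (m < ik.1)%N].

(** [T] serves both as the sample space and as its coarser version for the later turns, with [f] the
    identity in either case. *)
Lemma measurable_win_rcons (d' : measure_display) (T : measurableType d')
    (f : T -> Omega) p (s : seq R) :
    (forall i k, (size s < i < n)%N -> measurable_fun setT (fun x => U i k (f x))) ->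
  measurable [set z : R * T |
    wins p (play sigma (fun i k => U i k (f z.2)) (n - (size s).+1) (rcons s z.1))].
Proof.
move=> mU.
apply: (measurable_wins_play (T := (R * T)%type) (v := fun i k z => U i k (f z.2)) msigma p
  (q := (size s).+1) (hist := fun z => rcons s z.1)) => //.
- by move=> z; rewrite size_rcons.
- move=> j; under eq_fun do rewrite nth_rcons.
  case: (j < size s)%N; first exact: measurable_cst.
  by case: (j == size s); [exact: measurable_fst|exact: measurable_cst].
- move=> i k /andP[si is_].
  apply: (measurableT_comp (f := fun x => U i k (f x))) => //.
  apply: mU; rewrite si /=; lia.
Qed.

Lemma measurable_win_after_rcons p s :
  measurable_fun setT (fun x => win_after p (rcons s x)).
Proof.
have mE := @measurable_win_rcons _ Omega id p s (fun i k _ => measurable_funPT (U i k)).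
set E := [set _ | _] in mE.
rewrite (_ : (fun _ => _) = fubini_F P (EFin \o \1_E)).
  apply: measurable_fun_fubini_tonelli_F; first exact/measurable_EFinP/measurable_indic.
  by move=> z; rewrite /= lee_fin.
apply/funext => x; rewrite /fubini_F /=.
transitivity (\int[P]_w (\1_[set w | wins p (play sigma (fun i k => U i k w)
    (n - size (rcons s x)) (rcons s x))] w)%:E)%E.
  by rewrite integral_indic ?setIT//; exact: measurable_win_after_set.
apply: eq_integral => w _; rewrite !indicE; congr (_%:R%:E); congr nat_of_bool.
by apply/idP/idP; rewrite !inE /= size_rcons.
Qed.

(** The score of this turn and the continuation of the game use disjoint families of draws, so the
    score can be frozen while the later draws are integrated out. *)
Lemma win_after_turn p s pi : (size s < n)%N -> measurable_policy pi ->
  (P [set w | wins p (play sigma (fun i k => U i k w) (n - (size s).+1)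
      (rcons s (turn_score pi (draws (U (size s)) w))))] =
   \int[P]_w win_after p (rcons s (turn_score pi (draws (U (size s)) w))))%E.
Proof.
move=> sn mpi; have [_ indepU] := iidU; set m := size s.
have mE := @measurable_win_rcons _ (sigma_of X (later_turns m)) id p s.
have {}mE := mE (fun i k H => measurable_sigma_of (X := X) (J := later_turns m)
  (i := (Ordinal (proj2 (andP H)), k)) (proj1 (andP H))).
set E := [set _ | _] in mE.
pose Y w := turn_score pi (draws (U m) w).
have mY : @measurable_fun _ _ (sigma_of X (this_turn m)) R setT Y.
  have mv k : @measurable_fun _ _ (sigma_of X (this_turn m)) R setT (U m k).
    exact: (measurable_sigma_of (X := X) (J := this_turn m) (i := (Ordinal sn, k)) erefl).
  exact: (measurable_turn_score mv (fun k => measurable_policy_mkseq mv k mpi)).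
have mYO : measurable_fun setT Y.
  have mv k : measurable_fun setT (U m k) by exact: measurable_funPT.
  exact: (measurable_turn_score mv (fun k => measurable_policy_mkseq mv k mpi)).
have J12 : this_turn m `&` later_turns m = set0.
  by apply/seteqP; split => // ik [/= e]; rewrite /later_turns /= e ltnn.
have := @indep_integral _ _ _ P _ X indepU _ _ _ R Y (EFin \o \1_E) J12 mY.
have m1 : measurable_fun setT (EFin \o (\1_E : R * sigma_of X (later_turns m) -> R)).
  exact/measurable_EFinP/measurable_indic.
have E0 (z : R * sigma_of X (later_turns m)) : (0 <= (EFin \o (\1_E : _ -> R)) z)%E.
  by rewrite /= lee_fin.
move=> /(_ m1 E0) H.
have mS : measurable [set w | wins p (play sigma (fun i k => U i k w) (n - m.+1) (rcons s (Y w)))].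
  apply: (measurable_wins_play (v := fun i k w => U i k w) msigma p (q := m.+1)
    (hist := fun w => rcons s (Y w))) => //.
  - by move=> w; rewrite size_rcons.
  - move=> j; under eq_fun do rewrite nth_rcons.
    case: (j < size s)%N; first exact: measurable_cst.
    by case: (j == size s); [exact: mYO|exact: measurable_cst].
transitivity (\int[P]_w (\1_E (Y w, w))%:E)%E.
  transitivity (\int[P]_w (\1_[set w |
    wins p (play sigma (fun i k => U i k w) (n - m.+1) (rcons s (Y w)))] w)%:E)%E.
    by rewrite integral_indic ?setIT.
  apply: eq_integral => w _; rewrite !indicE; congr (_%:R%:E).
rewrite H.
apply: eq_integral => w _.
transitivity (\int[P]_w' (\1_[set w' | wins p (play sigma (fun i k => U i k w')
    (n - size (rcons s (Y w))) (rcons s (Y w)))] w')%:E)%E.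
  apply: eq_integral => w' _; rewrite /= !indicE; congr (_%:R%:E); congr nat_of_bool.
  by apply/idP/idP; rewrite !inE /= size_rcons.
by rewrite integral_indic ?setIT//; exact: measurable_win_after_set.
Qed.

End Game.

(** * Threshold policies and nonnegativity of scores *)

Section Policies.
Context {R : realType}.

Definition threshold_policy (kappa : R) : policy R := fun s => kappa < \sum_(x <- s) x.

Lemma measurable_threshold_policy kappa : measurable_policy (threshold_policy kappa).
Proof.
move=> k; apply: measurable_fun_ltr => //.
under eq_fun do rewrite big_tuple.
by apply: measurable_sum => i; exact: measurable_tnth.
Qed.

Lemma threshold_policy_follows kappa : follows_threshold kappa (threshold_policy kappa).
Proof.
by move=> s; split => H; rewrite /threshold_policy//; apply/negbTE; rewrite -leNgt ltW.
Qed.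

Lemma measurable_profile_policy (sigma : profile R) s : measurable_profile sigma ->
  measurable_policy (sigma s).
Proof.
move=> msigma k.
rewrite (_ : (fun _ => _) = (fun z : (size s).-tuple R * k.-tuple R => sigma z.1 z.2) \o
  (fun t : k.-tuple R => (in_tuple s, t)))//.
apply: (measurableT_comp (msigma (size s) k)).
by apply: measurable_fun_pair => //; exact: measurable_cst.
Qed.

Lemma turn_score_ge0 pi (u : nat -> R) : (forall k, 0 <= u k) -> 0 <= turn_score pi u.
Proof.
move=> u0; rewrite /turn_score; case: pselect => // e /=; case: ifP => // _.
by apply: sumr_ge0 => i _.
Qed.

End Policies.

(** * Backward induction over the players *)

Section Backward.
Context {R : realType} {d : measure_display} {Omega : measurableType d}.
Variables (P : probability Omega R) (n : nat) (U : nat -> nat -> {RV P >-> R}).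
Variable sigma : profile R.
Hypothesis iidU : iid_uniform n U.
Hypothesis msigma : measurable_profile sigma.

Local Notation win_after := (win_after n U sigma).

(** This is the payoff [g] of the one-turn stopping problem faced at the history [s]. *)
Definition stop_payoff (s : seq R) (x : R) : R := fine (win_after (size s) (rcons s x)).

Lemma win_after_fin p s : win_after p s \is a fin_num.
Proof.
have /andP[h0 h1] := win_after_range n U msigma p s.
by rewrite ge0_fin_numE// (le_lt_trans h1)// ltry.
Qed.

Lemma stop_payoff_range s x : 0 <= stop_payoff s x <= 1.
Proof.
have := win_after_range n U msigma (size s) (rcons s x).
by rewrite -(fineK (win_after_fin _ _)) !lee_fin.
Qed.

Lemma measurable_stop_payoff s : measurable_fun setT (stop_payoff s).
Proof.
by apply: (measurableT_comp (f := fine)) => //; exact: measurable_win_after_rcons.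
Qed.

Lemma stop_payoff_lose s x : x <= max_score s -> stop_payoff s x = 0.
Proof.
move=> xM; rewrite /stop_payoff win_after_lost// ?size_rcons//.
by move=> /wins_rcons; rewrite ltNge xM.
Qed.

Lemma win_probE s pi : (size s < n)%N -> measurable_policy pi ->
  win_prob n U sigma s pi =
  (\int[P]_w (stop_payoff s (turn_score pi (draws (U (size s)) w)))%:E)%E.
Proof.
move=> sn mpi; rewrite /win_prob (win_after_turn iidU msigma (size s) sn mpi).
by apply: eq_integral => w _; rewrite /stop_payoff fineK// win_after_fin.
Qed.

(** Histories longer than [q] are those at which optimality of the player to move is assumed. The
    leading score is kept below 1 because the next player's optimal behaviour is determined only
    when his threshold is below 1. *)
Definition survival_claim (q r : nat) : Prop := forall p s, (size s + r)%N = n ->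
  (q < size s)%N -> valid_history s -> (p < size s)%N -> wins p s -> s`_p < 1 ->
  win_after p s = (survival r s`_p)%:E.

Section Step.
Variables (q r : nat) (s : seq R).
Hypothesis claim : survival_claim q r.
Hypotheses (sr : (size s + r.+1)%N = n) (qs : (q <= size s)%N) (vs : valid_history s).

Lemma stop_payoff_survival x : max_score s < x -> x < 1 ->
  stop_payoff s x = survival r x.
Proof.
move=> Mx x1; have /andP[M0 _] := max_score_range vs.
have e : (rcons s x)`_(size s) = x by rewrite nth_rcons ltnn eqxx.
rewrite /stop_payoff (claim (p := size s)) ?e ?size_rcons//.
- by rewrite addSnnS.
- by apply: valid_rcons => //; apply/andP; split; lra.
- exact/wins_rcons.
Qed.

Lemma stop_payoff_high x : max_score s < x -> theta r.+1 <= x -> x < 1 ->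
  stop_payoff s x = bust_prob x ^+ r.
Proof. by move=> Mx tx x1; rewrite stop_payoff_survival// survival_high. Qed.

Lemma stop_payoff_low x : max_score s < x -> x < theta r.+1 ->
  stop_payoff s x <= bust_prob (theta r.+1) ^+ r.
Proof.
move=> Mx xt; have /andP[M0 _] := max_score_range vs.
rewrite stop_payoff_survival//; last exact: lt_trans xt (theta_lt1 _).
by apply: survival_low => //; lra.
Qed.

Lemma history_size_lt : (size s < n)%N. Proof. by rewrite -sr -addSnnS leq_addr. Qed.

Lemma threshold_optimal pi : measurable_policy pi ->
  follows_threshold (Num.max (theta r.+1) (max_score s)) pi ->
  optimal_policy n U sigma s pi.
Proof.
move=> mpi thr pi' mpi'; rewrite !win_probE ?history_size_lt//.
have uu := fun k B => @unif_turn _ _ _ _ _ _ iidU (size s) k B history_size_lt.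
have iu := indep_turn iidU history_size_lt.
rewrite (threshold_expected_payoff uu iu (measurable_stop_payoff s) (stop_payoff_range s)
  (max_score_range vs) (fun x _ => @stop_payoff_lose s x) stop_payoff_high mpi thr).
exact: (expected_payoff_le_cont_value uu iu (measurable_stop_payoff s) (stop_payoff_range s)
  (max_score_range vs) (fun x _ => @stop_payoff_lose s x) stop_payoff_high stop_payoff_low mpi').
Qed.

(** An optimal policy earns at least as much as the threshold policy, which attains F(0), so the
    almost sure uniqueness of optimal play applies. *)
Lemma optimal_losing_prob pi : measurable_policy pi -> optimal_policy n U sigma s pi ->
  0 < max_score s < 1 ->
  P [set w | turn_score pi (draws (U (size s)) w) < max_score s] =
  (bust_prob (Num.max (theta r.+1) (max_score s)))%:E.
Proof.
move=> mpi opt /andP[M0 M1].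
have uu := fun k B => @unif_turn _ _ _ _ _ _ iidU (size s) k B history_size_lt.
have iu := indep_turn iidU history_size_lt.
apply: (optimal_score_lt_prob uu iu (measurable_stop_payoff s) (stop_payoff_range s)
  (max_score_range vs) (fun x _ => @stop_payoff_lose s x) stop_payoff_high stop_payoff_low
  M0 _ mpi).
  by rewrite gt_max theta_lt1.
have := opt _ (measurable_threshold_policy (Num.max (theta r.+1) (max_score s))).
rewrite !win_probE ?history_size_lt//; last exact: measurable_threshold_policy.
by rewrite (threshold_expected_payoff uu iu (measurable_stop_payoff s) (stop_payoff_range s)
  (max_score_range vs) (fun x _ => @stop_payoff_lose s x) stop_payoff_high
  (measurable_threshold_policy _) (threshold_policy_follows _)).
Qed.

End Step.

(** Induction on the number of players left. The leading score is the one the next player must beat;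
    optimality gives his failure probability, after which [p] still leads with one player fewer to
    come. *)
Lemma survivalP q : optimal_after n U sigma q -> forall r, survival_claim q r.
Proof.
move=> opt; elim=> [|r claim] p s sr qs vs ps ws s1.
  rewrite /win_after -sr addn0 subnn /survival big_ord0 -(@probability_setT _ _ _ P).
  by congr (P _); apply/seteqP; split.
have sn := history_size_lt sr; have mps := measurable_profile_policy s msigma.
have eM := wins_max_score ps ws vs.
have s0 : 0 < s`_p by case: ws.
set Y := fun w => turn_score (sigma s) (draws (U (size s)) w).
have mY : measurable_fun setT Y.
  have mv k : measurable_fun setT (U (size s) k) by exact: measurable_funPT.
  exact: (measurable_turn_score mv (fun k => measurable_policy_mkseq mv k mps)).
have mA : measurable [set w | Y w < s`_p].
  rewrite (_ : [set _ | _] = Y @^-1` `]-oo, s`_p[).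
    by rewrite -[X in measurable X]setTI; exact: mY.
  by apply/seteqP; split => w /=; rewrite in_itv.
have PA : P [set w | Y w < s`_p] = (bust_prob (Num.max (theta r.+1) s`_p))%:E.
  have := @optimal_losing_prob q r s claim sr (ltnW qs) vs (sigma s) mps.
  rewrite eM; apply; last by rewrite s0.
  by apply: opt => //; rewrite qs.
have surv0 : 0 <= survival r s`_p.
  apply: prodr_ge0 => j _; apply: bust_prob_ge0; first by rewrite le_max theta_ge0.
  by rewrite ge_max theta_le1 ltW.
have -> : win_after p s = (\int[P]_w win_after p (rcons s (Y w)))%E.
  rewrite -(win_after_turn iidU msigma p sn mps) /win_after; congr (P _).
  have -> : (n - size s = (n - (size s).+1).+1)%N by lia.
  by [].
(* If the next score stays below that of [p], the induction hypothesis gives the conditional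
   probability; if it ties or exceeds it, [p] can no longer win. *)
transitivity (\int[P]_w ((survival r s`_p)%:E * (\1_[set w | Y w < s`_p] w)%:E))%E.
  apply: ge0_ae_eq_integral => //.
  - apply: (measurableT_comp (f := fun x => win_after p (rcons s x))) => //.
    exact: measurable_win_after_rcons.
  - apply: emeasurable_funM; first exact: measurable_cst.
    exact/measurable_EFinP/measurable_indic.
  - by move=> w _; rewrite mule_ge0// lee_fin.
  have uu := fun k B => @unif_turn _ _ _ _ _ _ iidU (size s) k B sn.
  (* Almost surely the draws are nonnegative, which keeps the extended history valid. *)
  apply: filterS (draws_range uu) => w u01 _.
  have Y0 : 0 <= Y w by apply: turn_score_ge0 => k; case/andP: (u01 k).
  have Y1 : Y w <= 1 by exact: turn_score_le1.
  rewrite indicE; have [Ys|sY] := ltP (Y w) s`_p.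
    rewrite mem_set//= mule1 (claim p)//.
    + by rewrite nth_rcons ps.
    + by rewrite size_rcons addSnnS.
    + by rewrite size_rcons ltnW.
    + by apply: valid_rcons => //; rewrite Y0.
    + by rewrite size_rcons ltnW.
    + exact/(wins_rcons_lt _ ps ws).
    + by rewrite nth_rcons ps.
  rewrite memNset/=; last by apply/negP; rewrite -leNgt.
  rewrite mule0 win_after_lost ?size_rcons 1?ltnW//.
  by move=> /(wins_rcons_lt _ ps ws); rewrite ltNge sY.
rewrite ge0_integralZl//.
- by rewrite integral_indic//= setIT PA survivalS -EFinM.
- exact/measurable_EFinP/measurable_indic.
Qed.

End Backward.

Theorem proposition2 (R : realType) (d : measure_display)
    (Omega : measurableType d) (P : probability Omega R)
    (n r : nat) (U : nat -> nat -> {RV P >-> R})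
    (sigma : profile R) (h : seq R) :
  iid_uniform n U ->
  (1 <= r <= n)%N ->
  size h = (n - r)%N ->
  valid_history h ->
  measurable_profile sigma ->
  optimal_after n U sigma (size h) ->
  optimum_threshold n U sigma h (Num.max (theta r) (max_score h)).
Proof.
move=> iidU /andP[r1 rn] sh vh msigma opt; split.
  exact/kappa_range/max_score_range.
move=> pi mpi thr.
case: r r1 rn sh thr => // r _ rn sh thr.
(* The player to move has number [size h]; the players numbered above it are exactly those assumed
   to play optimally. *)
apply: (threshold_optimal iidU msigma (q := size h) (r := r)) => //.
  exact: survivalP.
by rewrite sh subnK.
Qed.
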